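(* Let $d<D$ be positive integers, $\alpha>0$, and let $m,n$ be positive integers with $n=\lfloor m^{\alpha}\rfloor$ and $m,n$ sufficiently large with respect to $D$ and $\alpha$. Then there exist a prime $p$, a set $\mathcal{P}$ of $m$ points in $\mathbb{F}_p^D$ and a set $\mathcal{V}$ of $n$ varieties in $\mathbb{F}_p^D$, each of dimension $d$ and degree at most $\Delta=\lceil (1+\alpha)(d+1)\rceil^2$, such that the incidence graph $G(\mathcal{P},\mathcal{V})$ contains no copy of $K_{s,s}$ with $s=\Delta^{1/2}$, and \[ I(\mathcal{P},\mathcal{V}) \ge c\, m^{\frac{d}{d+1}}\, n, \] where $c>0$ depends only on $d$ and $\alpha$.
   Context: Varieties are irreducible algebraic sets (common zero sets of finitely many polynomials, not a union of two proper algebraic subsets), with the usual notions of dimension and degree. The incidence graph $G(\mathcal{P},\mathcal{V})$ is the bipartite graph with parts $\mathcal{P}$ and $\mathcal{V}$ where $x\in\mathcal{P}$ and $V\in\mathcal{V}$ are adjacent iff $x\in V$; $I(\mathcal{P},\mathcal{V})$ is its number of edges. *)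

(* Defs.v *)
From HB Require Import structures.
From mathcomp Require Import all_boot all_order all_algebra all_field.
From mathcomp Require Import finmap.
From mathcomp Require Import boolp classical_sets cardinality reals exp.
From mathcomp Require mpoly.
Import -(notations) mpoly.

Set Implicit Arguments.
Unset Strict Implicit.
Unset Printing Implicit Defensive.

Import Order.TTheory GRing.Theory Num.Theory.
Local Open Scope classical_set_scope.
Local Open Scope card_scope.
Local Open Scope ring_scope.

Section AffineVarieties.
Variables (K : closedFieldType) (D : nat).
Implicit Types (A B V : set 'rV[K]_D).

Definition zero_locus (S : seq (mpoly D K)) : set 'rV[K]_D :=
  [set x : 'rV[K]_D | forall f, f \in S -> meval (x ord0) f = 0].

Definition algebraic_set A := exists S, A = zero_locus S.

Definition variety V :=
  [/\ algebraic_set V, V !=set0 &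
      forall A B, algebraic_set A -> algebraic_set B ->
        V = A `|` B -> A = V \/ B = V].

Definition variety_chain V (k : nat) :=
  exists W : nat -> set 'rV[K]_D,
    [/\ forall i, (i <= k)%N -> variety (W i),
        forall i, (i < k)%N -> W i `<` W i.+1 &
        W k `<=` V].

Definition has_dim V (d : nat) :=
  variety_chain V d /\ forall k, variety_chain V k -> (k <= d)%N.

Definition affine_subspace_codim (d : nat) (L : set 'rV[K]_D) :=
  exists (M : 'M[K]_(D, d)) (b : 'rV[K]_d),
    \rank M = d /\ L = [set x : 'rV[K]_D | x *m M = b].

(* The degree of a d-dimensional affine variety, i.e. its number of
   intersection points with a generic affine subspace of codimension d,
   defined as the largest finite number of intersection points with such a
   subspace (Heintz). *)
Definition has_degree V (k : nat) :=
  exists2 d : nat, has_dim V d &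
    (exists2 L, affine_subspace_codim d L & V `&` L #= `I_k) /\
    (forall L j, affine_subspace_codim d L -> V `&` L #= `I_j -> (j <= k)%N).

End AffineVarieties.

Definition Fpbar (p : nat) : closedFieldType :=
  tag (countable_algebraic_closure 'F_p).

Definition to_Fpbar (p : nat) : {rmorphism 'F_p -> Fpbar p} :=
  sval (tagged (countable_algebraic_closure 'F_p)).

(* As usual, a variety in F_p^D is an irreducible algebraic set over the
   algebraic closure that is cut out by polynomials with coefficients in F_p.
   (Every nonempty irreducible set of F_p-rational points is a singleton, so
   positive-dimensional varieties cannot be seen on rational points alone.) *)
Definition variety_over_Fp (p D : nat) (V : set 'rV[Fpbar p]_D) :=
  variety V /\
  exists S : seq (mpoly D 'F_p),
    V = zero_locus [seq map_mpoly (to_Fpbar p) f | f <- S].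

Section Graphs.
Variables (T : finType) (e : rel T).

Definition num_edges : nat :=
  #|[set E : {set T} | [exists u, exists v, e u v && (E == [set u; v]%SET)]]%SET|.

Definition contains_Kss (s : nat) :=
  exists A B : {set T},
    [/\ #|A| = s, #|B| = s, forall x, x \in A -> x \notin B &
        forall a b, a \in A -> b \in B -> e a b].

End Graphs.

Section Incidences.
Variables (p D : nat).
Variables (P : {fset 'rV['F_p]_D}) (Vs : {fset set 'rV[Fpbar p]_D}).

Definition incident (x : 'rV['F_p]_D) (V : set 'rV[Fpbar p]_D) : bool :=
  map_mx (to_Fpbar p) x \in V.

Definition incidence_graph : rel (P + Vs)%type := fun u v =>
  match u, v with
  | inl x, inr V | inr V, inl x => incident (val x) (val V)
  | _, _ => false
  end.

Definition num_incidences : nat := num_edges incidence_graph.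

End Incidences.

(* Main.v *)
(* The varieties are graphs [x_d = f(x_0, ..., x_(d-1))], [x_j = 0] for [j > d],
   of polynomials [f] over [F_p] of degree less than [s^2], where [p] is a prime
   of order [m^(1/(d+1))]; such a prime exists by Chebyshev's study of the prime
   factors of a central binomial coefficient.

   Each graph is the image of affine d-space, hence irreducible. Its dimension
   is at most [d]: for a chain [W_0 < ... < W_k] of varieties, polynomials [g_i]
   that vanish on [W_i] but not on [W_(i+1)] are algebraically independent on
   [W_k], and counting monomials shows that more than [d] polynomials in [d]
   variables are dependent. A finite section by a linear space is the zero set
   of one polynomial on an affine space, and a finite such set has
   at most as many points as the degree.

   Random polynomials of degree less than [s^2] take independent uniform values
   at any [s] points, so a random [n]-tuple of them contains on average at most
   [C(n,s) C(p^(d+1),s) p^(-s^2) <= (s!)^(-2)] copies of [K_{s,s}] with the whole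
   of [F_p^(d+1)], because [n p^(d+1) <= p^s]. Some tuple of distinct polynomials
   has none; choosing the [m] points of largest multiplicity leaves at least
   [m n / p] incidences. *)

Require Import Defs.
From HB Require Import structures.
From mathcomp Require Import all_boot all_order all_algebra all_field.
From mathcomp Require Import finmap.
From mathcomp Require Import boolp classical_sets cardinality reals exp.
From mathcomp Require Import zify.
From mathcomp Require mpoly.
Import -(notations) mpoly.
Import Order.TTheory GRing.Theory Num.Theory.
Local Open Scope ring_scope.

Set Implicit Arguments.
Unset Strict Implicit.
Unset Printing Implicit Defensive.

(** * Primes between [x] and [8 x] *)

Section PrimeGaps.
Local Open Scope nat_scope.

Lemma leq_exp2_bin n : 2 ^ n <= 'C(n.*2, n).
Proof.
elim: n => // n IH; rewrite doubleS expnS mul2n -addnn binS leq_add //.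
- by rewrite binS (leq_trans IH) // leq_addl.
- by rewrite (leq_trans IH) // leq_bin2l.
Qed.

Lemma bin_leq_exp2 n k : 'C(n, k) <= 2 ^ n.
Proof.
elim: n k => [|n IH] [|k] //; first by rewrite bin0 expn_gt0.
by rewrite binS expnS mul2n -addnn leq_add.
Qed.

Lemma prod_dvdn_primes (r : seq nat) m :
  uniq r -> {in r, forall p, prime p && (p %| m)} ->
  \prod_(p <- r) p %| m.
Proof.
elim: r m => [|p r IH] m /=; first by rewrite big_nil dvd1n.
move=> /andP[pr ur] H; rewrite big_cons.
have /andP[p_pr pm] := H p (mem_head _ _).
have Hr : {in r, forall q, prime q && (q %| m)}.
  by move=> q qr; apply: H; rewrite inE qr orbT.
have cop : coprime p (\prod_(q <- r) q).
  rewrite big_seq; apply: (big_ind (fun z => coprime p z)) => [|x y px py|q qr].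
  - exact: coprimen1.
  - by rewrite coprimeMr px.
  have /andP[q_pr _] := Hr q qr.
  by rewrite prime_coprime // dvdn_prime2 //; apply: contra pr => /eqP->.
by rewrite Gauss_dvd // pm IH.
Qed.

(** A prime in [(h, x]] divides [x!] but neither [h!] nor [(x - h)!], so the product of these primes
    divides ['C(x, h)]. *)
Lemma primorial_half x h : h <= x -> x - h <= h ->
  \prod_(h.+1 <= p < x.+1 | prime p) p <= 2 ^ x.
Proof.
move=> hx xh; apply: leq_trans (bin_leq_exp2 x h).
apply: dvdn_leq; first by rewrite bin_gt0.
rewrite -big_filter; apply: prod_dvdn_primes.
  by rewrite filter_uniq // iota_uniq.
move=> p; rewrite mem_filter mem_index_iota => /and3P[p_pr hp px].
rewrite p_pr /=; have := bin_fact hx => E.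
have px' : p %| x`! by rewrite dvdn_fact // prime_gt0.
have nfact k : k < p -> ~~ (p %| k`!).
  move=> kp; rewrite fact_prod big_seq.
  apply: (big_ind (fun z => ~~ (p %| z))) => [|a b Ha Hb|i].
  - by rewrite Euclid_dvd1.
  - by rewrite Euclid_dvdM // negb_or Ha.
  - rewrite mem_index_iota => /andP[i0 ik]; apply/negP => /(dvdn_leq i0) pi.
    by lia.
move: px'; rewrite -E !Euclid_dvdM // => /or3P[//|H|H].
  by move: H; rewrite (negbTE (nfact h _)).
by move: H; rewrite (negbTE (nfact _ _)) //; lia.
Qed.

(** Induction by halving. Rounding up defeats the base 4 for odd [x], whereas with base 8 the
    exponents satisfy [3 * uphalf x + x <= 3 * x] once [2 <= x]. *)
Lemma primorial_leq x : \prod_(0 <= p < x.+1 | prime p) p <= 8 ^ x.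
Proof.
elim/ltn_ind: x => x IH.
case: (ltnP x 2) => [x2|x2].
  by case: x x2 {IH} => [|[|//]] _; rewrite unlock.
have hx : uphalf x <= x by rewrite leq_uphalf_double; lia.
have E := odd_double_half x.
have uE : uphalf x = odd x + x./2 by rewrite uphalf_half.
rewrite (big_cat_nat _ (n := (uphalf x).+1)) //=.
have H1 := IH (uphalf x) ltac:(lia).
have H2 := @primorial_half x (uphalf x) hx ltac:(lia).
apply: leq_trans (leq_mul H1 H2) _.
rewrite (_ : 8 = 2 ^ 3) // -!expnM -expnD leq_exp2l //; lia.
Qed.

(** By Legendre's formula the valuation is the sum over [k] of [n.*2 %/ p ^ k - 2 * (n %/ p ^ k)].
    Each term is at most 1, and it vanishes once [p ^ k] exceeds [n.*2]. *)
Lemma logn_central_bin p n : prime p -> 0 < n ->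
  logn p 'C(n.*2, n) <= trunc_log p n.*2.
Proof.
move=> p_pr n0.
have p1 := prime_gt1 p_pr.
have nn : n <= n.*2 by lia.
have := bin_fact nn; rewrite -[in n.*2 - n]addnn addnK => E.
have := congr1 (logn p) E.
rewrite !lognM ?muln_gt0 ?fact_gt0 ?bin_gt0 // !logn_fact //.
have ext : \sum_(1 <= k < n.+1) n %/ p ^ k = \sum_(1 <= k < n.*2.+1) n %/ p ^ k.
  rewrite [RHS](big_cat_nat _ (n := n.+1)) //=.
  rewrite -[LHS]addn0; congr addn; apply/esym/big1_seq => k /andP[_].
  rewrite mem_index_iota => /andP[nk _].
  by rewrite divn_small // (ltn_trans nk) // ltn_expl.
rewrite ext => EE.
have trl : trunc_log p n.*2 <= n.*2.
  apply: leq_trans (_ : p ^ trunc_log p n.*2 <= _).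
    by apply: ltnW; apply: ltn_expl.
  by apply: trunc_logP => //; lia.
have H : \sum_(1 <= k < n.*2.+1) n.*2 %/ p ^ k <=
    \sum_(1 <= k < n.*2.+1) ((k <= trunc_log p n.*2) + (n %/ p ^ k + n %/ p ^ k)).
  apply: leq_sum => k _.
  have pk0 : 0 < p ^ k by rewrite expn_gt0 prime_gt0.
  case: (leqP k _) => kt.
    rewrite -ltnS ltn_divLR //= add1n mulSn mulSn mulnDl.
    have := ltn_ceil n pk0; rewrite mulSn; move: (_ %/ _ * _) => a Ha.
    by rewrite -addnn; lia.
  rewrite divn_small //.
  by have := @trunc_log_ltn p n.*2 p1; move=> h; apply: leq_trans h _; rewrite leq_exp2l.
move: H; rewrite !big_split /= -EE => H.
have {H} : logn p 'C(n.*2, n) <= \sum_(1 <= k < n.*2.+1) (k <= trunc_log p n.*2).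
  by move: H; rewrite leq_add2r.
move=> /leq_trans; apply.
rewrite (big_cat_nat _ (n := (trunc_log p n.*2).+1)) //=.
rewrite [X in _ + X]big1_seq ?addn0; last first.
  by move=> k /andP[_]; rewrite mem_index_iota => /andP[kt _]; rewrite leqNgt kt.
rewrite (eq_big_nat _ _ (F2 := fun=> 1)) => [|k /andP[_ kt]]; last by rewrite -ltnS kt.
by rewrite sum_nat_const_nat muln1 subn1.
Qed.

(** Serves to refute the final estimate of [prime_between], where [r] is the integer square root of
    [8 * x] and so [r ^ 2 %/ 8 <= x]. *)
Lemma exp_beats_root_power r : 256 <= r -> r.+1 ^ (r.+1).*2 < 2 ^ (r ^ 2 %/ 8).
Proof.
move=> r256; set q := r %/ 64.
have rq : r.+1 <= 2 ^ (q + 6).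
  rewrite expnD; have : q.+1 <= 2 ^ q by apply: ltn_expl.
  have := divn_eq r 64; have := @ltn_pmod r 64 isT; rewrite -/q.
  by rewrite (_ : 2 ^ 6 = 64) //; lia.
have q64 : q * 64 <= r by rewrite /q leq_trunc_div.
apply: leq_ltn_trans (_ : (2 ^ (q + 6)) ^ (r.+1).*2 < _).
  by rewrite leq_exp2r.
rewrite -expnM ltn_exp2l //.
have := @leq_div2r 8 (((q + 6) * (r.+1).*2).+1 * 8) (r ^ 2); rewrite mulnK //.
apply; rewrite -mul2n expnS expn1; nia.
Qed.

Lemma prod_if_leq_const a r b : 0 < a ->
  \prod_(0 <= p < b) (if p <= r then a else 1) <= a ^ r.+1.
Proof.
move=> a0; have -> : \prod_(0 <= p < b) (if p <= r then a else 1) = a ^ minn b r.+1.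
  elim: b => [|b IH]; first by rewrite big_geq // min0n.
  rewrite big_nat_recr //= IH; case: (leqP b r) => br.
    by rewrite (_ : minn b.+1 _ = (minn b r.+1).+1) ?expnSr //; lia.
  by rewrite muln1; congr (_ ^ _); lia.
by rewrite leq_pexp2l //; lia.
Qed.

Lemma prod_if_leq_primes x b :
  \prod_(0 <= p < b) (if prime p && (p <= x) then p else 1) <=
  \prod_(0 <= p < x.+1 | prime p) p.
Proof.
have pos (i j : nat) (P : pred nat) :
    0 < \prod_(i <= p < j | prime p && P p) p.
  by apply: prodn_cond_gt0 => p /andP[/prime_gt0].
have -> : \prod_(0 <= p < x.+1 | prime p) p =
          \prod_(0 <= p < x.+1 | prime p && (p <= x)) p.
  rewrite big_nat_cond [RHS]big_nat_cond; apply: eq_bigl => p.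
  by rewrite ltnS; case: (p <= x); rewrite ?andbF ?andbT.
rewrite -big_mkcond; case: (leqP b x.+1) => bx.
  by rewrite [leqRHS](big_cat_nat _ (n := b)) //= leq_pmulr.
rewrite (big_cat_nat _ (n := x.+1)) //=; last exact: ltnW.
rewrite [X in _ * X <= _]big_nat_cond [X in _ * X <= _]big1 ?muln1 // => p.
by case/and3P=> /andP[xp _] _; rewrite leqNgt xp.
Qed.

(** If [(x, 8 * x]] contained no prime, then ['C(8 * x, 4 * x)], which is at least [16 ^ x], would
    be built from primes up to [x] alone. Those up to the root of [8 * x] contribute at most [8 * x]
    each, the others at most [8 ^ x] together, which is too little. *)
Lemma prime_between : exists x0, forall x, x0 <= x ->
  exists p, [/\ prime p, x < p & p <= 8 * x].
Proof.
(* This threshold gives [256 ^ 2 = 8 * 2 ^ 13 <= 8 * x], the range in which [exp_beats_root_power]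
   applies. *)
exists (2 ^ 13) => x x13; apply: contrapT => Hno.
have no p : prime p -> x < p -> 8 * x < p.
  by move=> pp xp; rewrite ltnNge; apply/negP => px; apply: Hno; exists p.
set n := 4 * x; have n0 : 0 < n by rewrite /n; lia.
have n2 : n.*2 = 8 * x by rewrite /n; lia.
have [r [r1 r2]] : exists r, r ^ 2 <= 8 * x < r.+1 ^ 2 /\ 256 <= r.
  have ex : exists k, k ^ 2 <= 8 * x by exists 0.
  have bd k : k ^ 2 <= 8 * x -> k <= 8 * x.
    by apply: leq_trans; case: k => // k; rewrite expnS expn1 leq_pmulr.
  case: (ex_maxnP ex bd) => r rx rmax; exists r; split.
    rewrite rx /= ltnNge; apply/negP => /rmax; lia.
  apply: rmax; apply: leq_trans (_ : 8 * 2 ^ 13 <= _); last by rewrite leq_mul2l.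
  by rewrite (_ : 8 = 2 ^ 3) // -expnD (_ : 256 = 2 ^ 8) // -expnM leq_exp2l.
case/andP: r1 => rx xr.
set B := 'C(n.*2, n); have B0 : 0 < B by rewrite bin_gt0; lia.
(* [g p] dominates the [p]-part of [B]: primes up to [r] give at most [n.*2], and a prime above [r]
   occurs at most once because its square exceeds [n.*2]. *)
pose g p := (if p <= r then n.*2 else 1) * (if prime p && (p <= x) then p else 1).
have EB : B = \prod_(0 <= p < B.+1) p ^ logn p B by rewrite -[LHS]partnT // /partn.
have lB : B <= \prod_(0 <= p < B.+1) g p.
  rewrite {1}EB; apply: leq_prod => p _; rewrite /g.
  case: (boolP (prime p)) => /= pp; last first.
    by rewrite lognE (negbTE pp) expn0 muln1; case: ifP => // _; lia.
  have lt := logn_central_bin pp n0.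
  have pl : p ^ logn p B <= n.*2.
    apply: leq_trans (_ : p ^ trunc_log p n.*2 <= _).
      by rewrite leq_exp2l // prime_gt1.
    by apply: trunc_logP; [exact: prime_gt1|lia].
  have p0 := prime_gt0 pp.
  case: (leqP p r) => pr.
    by apply: (leq_trans pl); rewrite leq_pmulr //; case: ifP.
  rewrite mul1n; case: (leqP p x) => px.
    rewrite -[leqRHS]expn1 leq_exp2l ?prime_gt1 //.
    have : p ^ logn p B < p ^ 2.
      apply: leq_ltn_trans pl _; rewrite n2; apply: leq_trans xr _.
      by rewrite leq_exp2r.
    by rewrite ltn_exp2l // prime_gt1.
  have h8 := no _ pp px.
  rewrite (_ : logn p B = 0) //; apply/eqP; rewrite -leqn0.
  apply: leq_trans lt _; rewrite leqn0 trunc_log_eq0; apply/orP; right; lia.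
have lB2 : \prod_(0 <= p < B.+1) g p <= n.*2 ^ r.+1 * 8 ^ x.
  rewrite big_split /=; apply: leq_mul; first by apply: prod_if_leq_const; lia.
  exact: leq_trans (prod_if_leq_primes _ _) (primorial_leq x).
have := leq_trans (leq_exp2_bin n) (leq_trans lB lB2).
(* Since [16 ^ x = 2 ^ x * 8 ^ x], the primorial bound cancels and [2 ^ x] remains against the small
   primes. *)
rewrite /n (expnM 2 4) (_ : 2 ^ 4 = 2 * 8) // expnMn leq_pmul2r ?expn_gt0 // => H.
have {H}H : 2 ^ x <= r.+1 ^ (r.+1).*2.
  apply: leq_trans H _; rewrite -/n -[(r.+1).*2]mul2n expnM leq_exp2r // n2.
  exact: ltnW.
have := exp_beats_root_power r2; rewrite ltnNge => /negP; apply.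
apply: leq_trans H; rewrite leq_exp2l //.
by apply: leq_trans (leq_div2r 8 rx) _; rewrite mulKn.
Qed.
End PrimeGaps.

(** * Polynomials over an algebraically closed field *)

Section DegreeBounds.
Variable R : idomainType.

(** [mmeasure mdeg] is the total degree plus one, and 0 for the zero polynomial; hence the
    successors in this and later degree bounds. *)
Lemma msizeM_deg n (p q : mpoly n R) a b :
  (mmeasure mdeg p <= a.+1)%N -> (mmeasure mdeg q <= b.+1)%N ->
  (mmeasure mdeg (p * q) <= (a + b).+1)%N.
Proof.
have [->|p0] := eqVneq p 0; first by rewrite mul0r mmeasure0.
have [->|q0] := eqVneq q 0; first by rewrite mulr0 mmeasure0.
move=> pa qb; rewrite msizeM // -subn1 leq_subLR; apply: leq_trans (leq_add pa qb) _.
by rewrite addSn addnS.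
Qed.

Lemma msizeX_deg n (p : mpoly n R) a j :
  (mmeasure mdeg p <= a.+1)%N -> (mmeasure mdeg (p ^+ j) <= (j * a).+1)%N.
Proof.
move=> pa; elim: j => [|j IH]; first by rewrite expr0 msize1.
by rewrite exprS mulSn; apply: msizeM_deg.
Qed.

End DegreeBounds.

Section ClosedFieldPolynomials.
Variable K : closedFieldType.

(** A root of the product of all ['X - a%:P] times ['X], plus 1, cannot lie in [s]. The extra factor
    ['X] keeps the degree positive when [s] is empty. *)
Lemma closed_field_avoid (s : seq K) : exists x, x \notin s.
Proof.
pose q : {poly K} := \prod_(a <- s) ('X - a%:P) * 'X + 1.
have mon : \prod_(a <- s) ('X - a%:P) \is monic by apply: monic_prod_XsubC.
have sz : size q = (size s).+2.
  rewrite /q size_polyDl size_mulX ?monic_neq0 ?size_prod_XsubC //.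
  by rewrite size_poly1.
have /closed_rootP[x] : size q != 1%N by rewrite sz.
rewrite rootE /q !hornerE => /eqP Hx; exists x; apply/negP => xs.
have /rootP x0 : root (\prod_(a <- s) ('X - a%:P)) x by rewrite root_prod_XsubC.
by move: Hx; rewrite x0 mul0r add0r; apply/eqP/oner_neq0.
Qed.

Lemma poly_eq0_cofinite (q : {poly K}) (s : seq K) :
  (forall x, x \notin s -> q.[x] = 0) -> q = 0.
Proof.
move=> H; have [r Er] := closed_field_poly_normal q.
have [x] := closed_field_avoid (s ++ r); rewrite mem_cat negb_or => /andP[xs xr].
have := H x xs; rewrite Er hornerZ => /eqP; rewrite mulf_eq0 lead_coef_eq0.
case/orP => [/eqP q0|]; first by rewrite q0 lead_coef0 scale0r.
by rewrite -/(root _ x) root_prod_XsubC (negbTE xr).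
Qed.

Lemma horner_mmap n (h : 'I_n -> {poly K}) (q : mpoly n K) (t : K) :
  (mmap polyC h q).[t] = meval (fun i => (h i).[t]) q.
Proof.
rewrite /meval /mmap horner_sum; apply: eq_bigr => m _.
rewrite hornerM hornerC /mmap1 horner_prod; congr (_ * _).
by apply: eq_bigr => i _; rewrite horner_exp.
Qed.

(** Uniqueness of base [E] expansions: reduction modulo [E] isolates the first digit. *)
Lemma digits_inj E n (f1 f2 : 'I_n -> nat) :
  (forall i, f1 i < E)%N -> (forall i, f2 i < E)%N ->
  (\sum_(i < n) E ^ i * f1 i = \sum_(i < n) E ^ i * f2 i)%N -> f1 =1 f2.
Proof.
elim: n f1 f2 => [|n IH] f1 f2 b1 b2 e; first by case.
move: e; rewrite !big_ord_recl /= expn0 !mul1n.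
have S (f : 'I_n.+1 -> nat) : (\sum_(i < n) E ^ bump 0 i * f (lift ord0 i) =
            E * \sum_(i < n) E ^ i * f (lift ord0 i))%N.
  by rewrite big_distrr /=; apply: eq_bigr => i _; rewrite /bump add1n expnS mulnA.
rewrite !S => e.
have e0 : f1 ord0 = f2 ord0.
  have := congr1 (modn^~ E) e.
  by rewrite !(addnC _ (E * _))%N !(mulnC E) !modnMDl !modn_small.
move: e; rewrite e0 => /addnI /eqP; rewrite eqn_pmul2l; last first.
  exact: leq_ltn_trans (b1 ord0).
move=> /eqP e i; case: (unliftP ord0 i) => [j|] -> //.
by apply: (IH (fun j => f1 (lift ord0 j)) (fun j => f2 (lift ord0 j))).
Qed.

(* Kronecker substitution: [x_i := t ^ (E ^ i)] with [E] larger than every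
   exponent sends distinct monomials to distinct powers of [t]. *)
Lemma mpoly_nonvanishing n (q : mpoly n K) :
  q != 0 -> exists v : 'I_n -> K, meval v q != 0.
Proof.
move=> q0; pose E := mmeasure mdeg q.
pose h (i : 'I_n) : {poly K} := 'X^(E ^ i).
pose wt (m : multinom n) := (\sum_(i < n) E ^ i * m i)%N.
have mmE m : mmap1 h m = 'X^(wt m).
  rewrite /mmap1 /wt (eq_bigr (fun i : 'I_n => 'X^(E ^ i * m i))) => [|i _].
    by rewrite prodrXr.
  by rewrite -exprM.
have wt_inj : {in msupp q &, injective wt}.
  move=> m1 m2 /msize_mdeg_lt lt1 /msize_mdeg_lt lt2.
  have bd (m : multinom n) (i : 'I_n) : (mdeg m < E)%N -> (m i < E)%N.
    by apply: leq_ltn_trans; rewrite mdegE (bigD1 i) //= leq_addr.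
  by move=> e; apply/mnmP; apply: digits_inj e => i; apply: bd.
have nz : mmap polyC h q != 0.
  move: q0; rewrite -msupp_eq0.
  case E0 : (msupp q) => [//|m0 r] _; apply/eqP => z.
  have m0s : m0 \in msupp q by rewrite E0 mem_head.
  have := congr1 (fun r : {poly K} => r`_(wt m0)) z; rewrite coef0 /mmap coef_sum.
  rewrite (bigD1_seq m0) ?msupp_uniq //= big1_seq ?addr0.
    rewrite mmE mul_polyC coefZ coefXn eqxx mulr1 => /eqP.
    by apply/negP; rewrite -mcoeff_msupp.
  move=> m /andP[mm0 ms]; rewrite mmE mul_polyC coefZ coefXn.
  case: eqP => [/wt_inj|]; last by rewrite mulr0.
  by move=> /(_ m0s ms) e; rewrite e eqxx in mm0.
have [t] : exists t, (mmap polyC h q).[t] != 0.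
  apply: contrapT => H; move/eqP: nz; apply; apply: (@poly_eq0_cofinite _ [::]) => x _.
  by apply/eqP; apply: contraT => nx; case: H; exists x.
by rewrite horner_mmap => H; exists (fun i => (h i).[t]).
Qed.

End ClosedFieldPolynomials.

(** * Irreducibility: vanishing of products, and images of affine space *)

Section Irreducibility.
Variable K : closedFieldType.

(** Adding [p] or [q] to the equations of [V] yields two algebraic subsets that cover [V], so one of
    them is all of [V]. *)
Lemma variety_prime D (V : set 'rV[K]_D) (p q : mpoly D K) : variety V ->
  (forall x, V x -> meval (x ord0) (p * q) = 0) ->
  (forall x, V x -> meval (x ord0) p = 0) \/
  (forall x, V x -> meval (x ord0) q = 0).
Proof.
case=> -[S VS] _ irr pq0.
case: (irr (zero_locus (p :: S)) (zero_locus (q :: S))); [by eexists|by eexists| | |].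
- apply/seteqP; split=> x.
    move=> Vx; have := pq0 x Vx; rewrite mevalM => /eqP; rewrite mulf_eq0.
    move: Vx; rewrite VS => Vx.
    by case/orP => /eqP h; [left|right] => g; rewrite inE => /orP[/eqP->|/Vx].
  by rewrite VS => -[] H g gS; apply: H; rewrite inE gS orbT.
- by move=> E; left => x; rewrite -E; apply; rewrite mem_head.
- by move=> E; right => x; rewrite -E; apply; rewrite mem_head.
Qed.

(** A proper algebraic subset of [W] has an equation whose pullback along [psi] is a nonzero
    polynomial. The product of two such pullbacks is nonzero at some parameter, whose image lies in
    neither subset. *)
Lemma variety_param D d (psi : D.-tuple (mpoly d K)) (W : set 'rV[K]_D) :
  algebraic_set W ->
  (forall a, W (\row_i meval a (tnth psi i))) ->
  (forall x, W x -> exists a, x = \row_i meval a (tnth psi i)) ->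
  variety W.
Proof.
move=> algW Wpsi psiW; split=> //; first by eexists; exact: (Wpsi (fun=> 0)).
move=> A B [SA ->] [SB ->] WE; apply: contrapT => /not_orP[nA nB].
have wit S : (zero_locus S `<=` W)%classic -> zero_locus S <> W ->
    exists2 g, g \in S & comp_mpoly psi g != 0.
  move=> SW nS; apply: contrapT => H; apply: nS; apply/seteqP; split=> // x Wx g gS.
  have [a ->] := psiW x Wx.
  have /eqP g0 : comp_mpoly psi g == 0.
    by apply: contraT => ng; case: H; exists g.
  have := comp_mpoly_meval a g psi; rewrite g0 meval0 => ->.
  by apply: meval_eq => i; rewrite mxE.
have [g gA g0] : exists2 g, g \in SA & comp_mpoly psi g != 0.
  by apply: wit => //; rewrite WE => x; left.
have [h hB h0] : exists2 h, h \in SB & comp_mpoly psi h != 0.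
  by apply: wit => //; rewrite WE => x; right.
have [a] := mpoly_nonvanishing (mulf_neq0 g0 h0).
rewrite mevalM !comp_mpoly_meval mulf_eq0 negb_or => /andP[ga ha].
have := Wpsi a; rewrite WE => -[/(_ g gA)|/(_ h hB)] e.
  by move/eqP: ga; apply; rewrite -e; apply: meval_eq => i; rewrite mxE.
by move/eqP: ha; apply; rewrite -e; apply: meval_eq => i; rewrite mxE.
Qed.

End Irreducibility.

(** * Upper bound on dimension through algebraic independence along chains *)

Section DimensionBound.
Variable K : closedFieldType.

Section Tower.
Variables (n : nat) (g : nat -> mpoly n K) (N : nat).

(* The polynomial in [g 0, ..., g (k - 1)] of degree less than [N] in each of
   them whose coefficient at the exponents [l] (exponent of [g (k - 1)] first)
   is [c l]. *)
Fixpoint tower k (c : seq nat -> K) : mpoly n K :=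
  if k is k'.+1 then \sum_(j < N) g k' ^+ j * tower k' (fun l => c (nat_of_ord j :: l))
  else mpolyC n (c [::]).

Lemma tower_ext k c c' :
  (forall l, size l = k -> all (fun j => (j < N)%N) l -> c l = c' l) ->
  tower k c = tower k c'.
Proof.
elim: k c c' => [|k IH] c c' H /=; first by rewrite H.
apply: eq_bigr => j _; congr (_ * _); apply: IH => l sl al.
by apply: H => /=; rewrite ?sl // ltn_ord.
Qed.

Lemma tower0 k : tower k (fun=> 0) = 0.
Proof.
elim: k => [|k IH] /=; first by rewrite mpolyC0.
by rewrite big1 // => j _; rewrite IH mulr0.
Qed.

Lemma tower_sum (I : finType) (v : I -> K) (c : I -> seq nat -> K) k :
  tower k (fun l => \sum_i v i * c i l) = \sum_i v i *: tower k (c i).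
Proof.
elim: k c => [|k IH] c /=.
  rewrite raddf_sum /=; apply: eq_bigr => i _.
  by rewrite mpolyCM mul_mpolyC.
rewrite (eq_bigr (fun j : 'I_N =>
  \sum_i v i *: (g k ^+ j * tower k (fun l => c i (nat_of_ord j :: l))))).
  rewrite exchange_big /=; apply: eq_bigr => i _; by rewrite scaler_sumr.
move=> j _; rewrite IH mulr_sumr; apply: eq_bigr => i _.
by rewrite -scalerAr.
Qed.

Lemma msize_tower e k c :
  (forall i, (i < k)%N -> (mmeasure mdeg (g i) <= e.+1)%N) ->
  (mmeasure mdeg (tower k c) <= (k * (N * e)).+1)%N.
Proof.
elim: k c => [|k IH] c ge /=; first by rewrite mmeasureC; case: eqP.
apply: leq_trans (mmeasure_sum _ _ _ _) _.
apply/bigmax_leqP_seq => j _ _; rewrite mulSn.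
apply: leq_trans (_ : (j * e + k * (N * e)).+1 <= _)%N.
  apply: msizeM_deg; first by apply: msizeX_deg; apply: ge.
  by apply: IH => i ik; apply: ge; apply: ltnW.
by rewrite ltnS leq_add2r leq_mul2r ltnW ?orbT.
Qed.

End Tower.

Lemma comp_tower n d (psi : n.-tuple (mpoly d K)) g N k c :
  comp_mpoly psi (tower g N k c) = tower (fun i => comp_mpoly psi (g i)) N k c.
Proof.
elim: k c => [|k IH] c /=; first by rewrite comp_mpolyC.
by rewrite rmorph_sum; apply: eq_bigr => j _; rewrite rmorphM rmorphXn /= IH.
Qed.

(** Each exponent of a monomial of degree less than [b] is itself less than [b]; this crude count
    suffices for [tower_dependent]. *)
Lemma card_bmultinom_leq d b : (#|{: bmultinom d b}| <= b ^ d)%N.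
Proof.
case: b => [|b].
  rewrite (_ : #|_| = 0%N) //; apply/eqP; rewrite -leqn0 leqNgt; apply/negP.
  by case/card_gt0P => -[m].
pose F (m : bmultinom d b.+1) : {ffun 'I_d -> 'I_b.+1} :=
  [ffun i => inord ((m : multinom d) i)].
suff inj : injective F by have := leq_card F inj; rewrite card_ffun !card_ord.
move=> m1 m2 e; apply/val_inj/mnmP => i.
have bd (m : bmultinom d b.+1) : ((m : multinom d) i < b.+1)%N.
  by apply: leq_ltn_trans (bmdeg m); rewrite mdegE (bigD1 i) //= leq_addr.
have := congr1 (fun f : {ffun 'I_d -> 'I_b.+1} => val (f i)) e.
by rewrite /F !ffunE /= !inordK.
Qed.

(** There are [N ^ k] products of powers of the [g i] with exponents below [N]. They live in a space
    of polynomials whose dimension grows only like [N ^ d], so for large [N] they are linearly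
    dependent. *)
Lemma tower_dependent d (g : nat -> mpoly d K) k : (d < k)%N ->
  exists N (c : seq nat -> K) l, [/\ tower g N k c = 0,
    size l = k, all (fun j => (j < N)%N) l & c l != 0].
Proof.
move=> dk; pose e := (\max_(i < k) mmeasure mdeg (g i))%N.
have ge i : (i < k)%N -> (mmeasure mdeg (g i) <= e.+1)%N.
  by move=> ik; apply: leqW; apply: (leq_bigmax (Ordinal ik)).
(* The degree bound satisfies [b <= N * (k * e).+1], so at most [N ^ d * (k * e).+1 ^ d] monomials
   occur; this is below [N ^ d.+1] exactly because [N] exceeds the second factor. *)
pose N := ((k * e).+1 ^ d).+1; pose b := (k * (N * e)).+1.
exists N.
pose T := k.-tuple 'I_N; pose M := bmultinom d b.
have lt : (#|{: M}| < #|{: T}|)%N.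
  rewrite card_tuple card_ord; apply: leq_ltn_trans (card_bmultinom_leq _ _) _.
  apply: leq_ltn_trans (_ : ((N * (k * e).+1) ^ d < _))%N.
    by case: (d) => [|d'] //; rewrite leq_exp2r // /b /N; lia.
  apply: leq_trans (_ : N ^ d.+1 <= _)%N; last by rewrite leq_exp2l // /N; lia.
  by rewrite expnMn expnSr ltn_pmul2l ?expn_gt0.
(* With the indicator [dl t] as coefficients, [tower] is the single product of powers with exponents
   [t]. The rows of [A] are these products in the monomial basis. *)
pose dl (t : T) (l : seq nat) : K := (map val t == l)%:R.
pose A : 'M[K]_(#|{: T}|, #|{: M}|) :=
  \matrix_(i, j) mcoeff (enum_val j : M) (tower g N k (dl (enum_val i))).
have [v v0 vA] : exists2 v : 'rV[K]_#|{: T}|, v != 0 & v *m A = 0.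
  have : kermx A != 0.
    rewrite -mxrank_eq0 mxrank_ker subn_eq0 -ltnNge.
    by apply: leq_ltn_trans (rank_leq_col _) lt.
  by case/rowV0Pn => v /sub_kermxP vA v0; exists v.
pose c l := \sum_(i < #|{: T}|) v ord0 i * dl (enum_val i) l.
have [i vi] : exists i, v ord0 i != 0.
  apply: contrapT => H; move/eqP: v0; apply; apply/rowP => i; rewrite mxE.
  by apply/eqP; apply: contraT => vi; case: H; exists i.
exists c, (map val (enum_val i : T)); split.
- rewrite tower_sum.
  set q := (X in X = 0).
  have sq : (mmeasure mdeg q <= b)%N by rewrite /q -tower_sum; apply: msize_tower.
  rewrite (mpolywE sq) big1 // => m _.
  have -> : mcoeff m q = (v *m A) ord0 (enum_rank m).
    rewrite /q raddf_sum mxE; apply: eq_bigr => j _.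
    by rewrite mxE enum_rankK /= mcoeffZ.
  by rewrite vA mxE scale0r.
- by rewrite size_map size_tuple.
- by apply/allP => j /mapP[j' _ ->]; apply: ltn_ord.
- rewrite /c (bigD1 i) //= /dl eqxx mulr1 big1 ?addr0 // => j ji.
  case: eqP => [e'|]; last by rewrite mulr0.
  by case/eqP: ji; apply: enum_val_inj; apply: val_inj; apply: (inj_map val_inj).
Qed.

(** Restricting a relation from [W k.+1] to [W k] kills all positive powers of [g k], so by
    induction the part free of [g k] has zero coefficients. The rest is divisible by [g k], which
    can be cancelled on the irreducible [W k.+1]. *)
Lemma tower_independent n (g : nat -> mpoly n K) N k (W : nat -> set 'rV[K]_n) c :
  (forall i, (i <= k)%N -> variety (W i)) ->
  (forall i, (i < k)%N -> W i `<=` W i.+1)%classic ->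
  (forall i, (i < k)%N -> forall x, W i x -> meval (x ord0) (g i) = 0) ->
  (forall i, (i < k)%N -> exists2 x, W i.+1 x & meval (x ord0) (g i) <> 0) ->
  (forall x, W k x -> meval (x ord0) (tower g N k c) = 0) ->
  forall l, size l = k -> all (fun j => (j < N)%N) l -> c l = 0.
Proof.
elim: k c => [|k IH] c Wv Wsub g0 g1 c0.
  have [_ [x Wx] _] := Wv 0%N isT.
  by move=> [|//] _ _; have := c0 x Wx; rewrite /= mevalC.
have {}IH c' := IH c' (fun i h => Wv i (leqW h)) (fun i h => Wsub i (leqW h))
  (fun i h => g0 i (leqW h)) (fun i h => g1 i (leqW h)).
(* Inner induction on the number of powers of [g k]: each round removes the constant part and
   divides by [g k], which shifts [c'] by one. *)
have step M (c' : nat -> seq nat -> K) :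
    (forall x, W k.+1 x ->
       meval (x ord0) (\sum_(j < M) g k ^+ j * tower g N k (c' j)) = 0) ->
    forall j, (j < M)%N -> forall l, size l = k -> all (fun j => (j < N)%N) l -> c' j l = 0.
  elim: M c' => [//|M IHM] c' Hc.
  have T0 l : size l = k -> all (fun j => (j < N)%N) l -> c' 0%N l = 0.
    apply: IH => x Wx; have := Hc x (Wsub k (ltnSn k) x Wx).
    rewrite big_ord_recl expr0 mul1r mevalD raddf_sum big1 ?addr0 //= => j _.
    by rewrite mevalM rmorphXn /= (g0 k) // exprS !mul0r.
  have E0 : tower g N k (c' 0%N) = 0.
    by rewrite -(tower0 g N k); apply: tower_ext.
  case=> [|j] jM; first exact: T0.
  apply: (IHM (fun j => c' j.+1)) => // x.
  have := @variety_prime K n (W k.+1) (g k)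
    (\sum_(j < M) g k ^+ j * tower g N k (c' j.+1)) (Wv _ (leqnn _)).
  case; last exact.
    move=> y Wy; rewrite -[RHS](Hc y Wy) big_ord_recl E0 mulr0 add0r; congr meval.
    by rewrite mulr_sumr; apply: eq_bigr => j' _; rewrite mulrA -exprS.
  by have [y Wy ny] := g1 k (ltnSn k) => /(_ y Wy).
move=> [//|j l] [sl] /= /andP[jN al].
by apply: (step N (fun j l => c (j :: l))).
Qed.

(** Pulled back along [psi], the polynomials separating consecutive members of a chain with [d < k]
    become dependent. The relation then vanishes on the image of [psi], hence on [W k], against
    [tower_independent]. *)
Lemma variety_chain_param D d (psi : D.-tuple (mpoly d K)) (V : set 'rV[K]_D) k :
  (forall x, V x -> exists a, x = \row_i meval a (tnth psi i)) ->
  variety_chain V k -> (k <= d)%N.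
Proof.
move=> psiV [W [Wv Wlt WV]]; rewrite leqNgt; apply/negP => dk.
(* The value 0 for [i >= k] is a filler that lets [choice] produce a total sequence. *)
have exg i : exists gi : mpoly D K, (i < k)%N ->
    (forall x, W i x -> meval (x ord0) gi = 0) /\
    (exists2 x, W i.+1 x & meval (x ord0) gi <> 0).
  case: (ltnP i k) => ik; last by exists 0.
  have [[S WS] _ _] := Wv i (ltnW ik); have [_ nsub] := Wlt i ik.
  apply: contrapT => H; apply: nsub => x Wx; rewrite WS => f fS.
  apply: contrapT => nf; apply: H; exists f => _; split; last by exists x.
  by move=> y; rewrite WS; apply.
have [g Hg] := choice exg.
have [N [c [l [t0 sl al cl]]]] := tower_dependent (fun i => comp_mpoly psi (g i)) dk.
move/eqP: cl; apply; apply: (@tower_independent _ g N k W c) => //.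
- by move=> i /Wlt[].
- by move=> i /Hg[].
- by move=> i /Hg[].
- move=> x /WV /psiV[a ->]; rewrite -comp_tower in t0.
  have := comp_mpoly_meval a (tower g N k c) psi; rewrite t0 meval0 => ->.
  by apply: meval_eq => i; rewrite mxE.
Qed.

End DimensionBound.

(** * Finite zero sets of one polynomial on an affine space *)

Section FiniteHypersurfaceSections.
Variables (K : closedFieldType) (n : nat).
Implicit Types (g : mpoly n K) (x w : 'rV[K]_n).

Definition line_poly g x w : {poly K} :=
  mmap polyC (fun i => (x ord0 i)%:P + w ord0 i *: 'X) g.

Lemma horner_line_poly g x w t :
  (line_poly g x w).[t] = meval ((x + t *: w) ord0) g.
Proof.
rewrite /line_poly horner_mmap; apply: meval_eq => i.
by rewrite !mxE hornerD hornerC hornerZ hornerX [t * _]mulrC.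
Qed.

Lemma size_line_poly g x w e :
  (mmeasure mdeg g <= e.+1)%N -> (size (line_poly g x w) <= e.+1)%N.
Proof.
move=> ge; apply: leq_trans (size_sum _ _ _) _.
apply/bigmax_leqP_seq => m ms _.
apply: leq_trans (_ : (mdeg m).+1 <= _)%N; last first.
  exact: leq_trans (msize_mdeg_lt ms) ge.
rewrite mul_polyC; apply: leq_trans (size_scale_leq _ _) _.
rewrite /mmap1 mdegE.
pose P (p : {poly K}) (k : nat) := (size p <= k.+1)%N.
apply: (big_ind2 P) => [|p a q b pa qb|i _]; rewrite /P.
- by rewrite size_poly1.
- apply: leq_trans (size_polyMleq _ _) _; rewrite -subn1 leq_subLR.
  by apply: leq_trans (leq_add pa qb) _; rewrite addSn addnS.
- apply: leq_trans (size_poly_exp_leq _ _) _; rewrite ltnS -[leqRHS]mul1n leq_mul2r.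
  apply/orP; right; rewrite -subn1 leq_subLR.
  apply: leq_trans (size_polyD _ _) _; rewrite geq_max.
  rewrite (leq_trans (size_polyC_leq1 _)) //.
  by rewrite (leq_trans (size_scale_leq _ _)) // size_polyX.
Qed.

Lemma line_not_subset x w (xs : seq 'rV[K]_n) : w != 0 ->
  exists t, x + t *: w \notin xs.
Proof.
case/rV0Pn => i wi.
have [t tP] := closed_field_avoid
  [seq ((y : 'rV[K]_n) ord0 i - x ord0 i) / w ord0 i | y <- xs].
exists t; apply: contra tP => ys; apply/mapP; eexists; first exact: ys.
by rewrite !mxE addrAC subrr add0r mulfK.
Qed.

(* If the zeros are collinear they are the roots of a nonzero univariate
   polynomial.  Otherwise three of them, [x0], [x0 + w], [x0 + u], span a plane
   in [L]; finitely many lines of the plane parallel to [w] meet the zero set, so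
   [g] is constant on all the other ones, hence on all of them, and so it
   vanishes on the line through [x0]. *)
Lemma size_finite_zeros g (L : set 'rV[K]_n) (xs : seq 'rV[K]_n) e :
  (forall x y z a b, L x -> L y -> L z -> L (x + a *: (y - x) + b *: (z - x))) ->
  (forall x, x \in xs <-> L x /\ meval (x ord0) g = 0) -> uniq xs ->
  (mmeasure mdeg g <= e.+1)%N -> (0 < e)%N -> (size xs <= e)%N.
Proof.
move=> Laff xsP xsU ge e0.
case: xs xsU xsP => [//|x0 [//|x1 r]]; set xs := x0 :: x1 :: r => xsU xsP.
pose w := x1 - x0.
have w0 : w != 0.
  move: xsU; rewrite /xs /= inE negb_or => /andP[/andP[+ _] _].
  by rewrite subr_eq0 eq_sym.
have [Lx0 gx0] : L x0 /\ meval (x0 ord0) g = 0 by apply/xsP; rewrite mem_head.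
have [Lx1 _] : L x1 /\ meval (x1 ord0) g = 0.
  by apply/xsP; rewrite inE mem_head orbT.
have line_nz : ~ (forall t, meval ((x0 + t *: w) ord0) g = 0).
  move=> H; have [t] := line_not_subset x0 xs w0; case/negP; apply/xsP; split=> //.
  by have := Laff x0 x1 x0 t 0 Lx0 Lx1 Lx0; rewrite scale0r addr0.
case: (boolP (all (fun x => (x - x0 <= w)%MS) xs)) => [/allP onl|/allPn[x2 x2s offl]].
  case/rV0Pn: (w0) => i wi.
  pose tm (x : 'rV[K]_n) := (x ord0 i - x0 ord0 i) / w ord0 i.
  have tmP x : x \in xs -> x = x0 + tm x *: w.
    move=> /onl /sub_rVP[a xa]; rewrite (_ : tm x = a).
      by rewrite -xa addrC subrK.
    have := congr1 (fun y : 'rV[K]_n => y ord0 i) xa.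
    by rewrite [LHS]mxE [X in _ + X]mxE [RHS]mxE /tm => ->; rewrite mulfK.
  pose q := line_poly g x0 w.
  have q0 : q != 0.
    by apply/eqP => q0; apply: line_nz => t; rewrite -horner_line_poly -/q q0 horner0.
  have : (size (map tm xs) < size q)%N.
    apply: max_poly_roots => //; last first.
      rewrite map_inj_in_uniq // => x y xxs yxs exy.
      by rewrite (tmP x) // (tmP y) // exy.
    apply/allP => t /mapP[x xx ->]; rewrite rootE /q horner_line_poly -tmP //.
    by have /xsP[_ ->] := xx.
  by rewrite size_map => /leq_trans/(_ (size_line_poly x0 w ge)); rewrite ltnS.
exfalso; pose u := x2 - x0.
have [Lx2 _] : L x2 /\ meval (x2 ord0) g = 0 by apply/xsP.
have wc : w *m cokermx w = 0 by apply: mulmx_coker.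
have [j uj] : exists j, (u *m cokermx w) ord0 j != 0.
  by move: offl; rewrite submxE => /rV0Pn.
(* Since [cokermx w] annihilates [w], [tm] reads off the coefficient along [u] and so labels the
   lines parallel to [w]. *)
pose tm (x : 'rV[K]_n) := ((x - x0) *m cokermx w) ord0 j / (u *m cokermx w) ord0 j.
have tmE a b : tm (x0 + a *: u + b *: w) = a.
  rewrite /tm (_ : _ - x0 = a *: u + b *: w); last first.
    by apply/eqP; rewrite subr_eq [_ + x0]addrC addrA.
  rewrite mulmxDl -!scalemxAl wc scaler0 addr0.
  by rewrite mxE mulfK.
have Lplane a b : L (x0 + a *: u + b *: w) by apply: Laff.
have const a b : a \notin map tm xs ->
    meval ((x0 + a *: u + b *: w) ord0) g = meval ((x0 + a *: u) ord0) g.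
  move=> an; pose G := line_poly g (x0 + a *: u) w.
  have sG : size G == 1%N.
    apply: contraT => /closed_rootP[t]; rewrite rootE horner_line_poly => /eqP g0.
    case/negP: an; apply/mapP; exists (x0 + a *: u + t *: w); last by rewrite tmE.
    by apply/xsP.
  have [k _ Gk] := size_poly1P _ sG.
  rewrite -horner_line_poly -/G Gk hornerC -[x0 + _]addr0 -(scale0r w).
  by rewrite -horner_line_poly -/G Gk hornerC.
apply: line_nz => b.
(* [H] compares two points of the line labelled [a], as a polynomial in [a]. It vanishes off the
   finitely many labels of zeros, hence also at [a = 0]. *)
pose H := line_poly g (x0 + b *: w) u - line_poly g x0 u.
have H0 : H = 0.
  apply: (@poly_eq0_cofinite _ _ (map tm xs)) => a an.
  by rewrite /H hornerD hornerN !horner_line_poly addrAC const // subrr.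
have := congr1 (horner^~ 0) H0.
by rewrite /H hornerD hornerN !horner_line_poly horner0 !scale0r !addr0 gx0 subr0.
Qed.

End FiniteHypersurfaceSections.

(** * The degree as a maximal finite section *)

Section Degree.
Variables (K : closedFieldType) (n : nat).

Lemma card_eq_II_seq (A : set 'rV[K]_n) j : (A #= `I_j)%card ->
  exists xs : seq 'rV[K]_n, [/\ uniq xs, size xs = j & forall x, x \in xs <-> A x].
Proof.
case/card_set_bijP => f [fsub finj fsurj].
have ex i : exists x, (i < j)%N -> A x /\ f x = i.
  case: (ltnP i j) => [ij|]; last by exists 0.
  by have [x Ax fx] := fsurj i ij; exists x.
have [h hP] := choice ex.
exists (map h (iota 0 j)); split; last 1 first.
- move=> x; split=> [/mapP[i]|Ax].
    by rewrite mem_iota add0n => /hP[Ah _] ->.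
  apply/mapP; exists (f x); first by rewrite mem_iota add0n; apply: fsub.
  have [Ah e] := hP (f x) (fsub x Ax).
  by apply: finj; rewrite ?inE.
- rewrite map_inj_in_uniq ?iota_uniq // => a b; rewrite !mem_iota !add0n.
  by move=> /hP[_ {2}<-] /hP[_ {2}<-] ->.
- by rewrite size_map size_iota.
Qed.

(** One finite section together with a uniform bound makes the maximum that defines the degree
    exist. *)
Lemma has_degree_leq (V : set 'rV[K]_n) d e : has_dim V d ->
  (exists L j, affine_subspace_codim d L /\ (V `&` L #= `I_j)%classic%card) ->
  (forall L j, affine_subspace_codim d L -> (V `&` L #= `I_j)%classic%card -> (j <= e)%N) ->
  exists2 k, has_degree V k & (k <= e)%N.
Proof.
move=> dV [L0 [j0 [cL0 VL0]]] bd.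
pose P j := `[< exists2 L, affine_subspace_codim d L & (V `&` L #= `I_j)%classic%card >].
have exP : exists j, P j by exists j0; apply/asboolP; exists L0.
have bdP j : P j -> (j <= e)%N by move/asboolP => [L]; apply: bd.
case: (ex_maxnP exP bdP) => k Pk kmax; exists k; last exact: bdP.
exists d => //; split; first exact/asboolP.
by move=> L j cL VL; apply: kmax; apply/asboolP; exists L.
Qed.

End Degree.

(** * Graphs of polynomials *)

Section GraphVarieties.
Variables (d D : nat) (ltdD : (d < D)%N).

Definition base_coord (i : 'I_d) : 'I_D := widen_ord (ltnW ltdD) i.
Definition graph_coord : 'I_D := Ordinal ltdD.

Section Embedding.
Variable R : comNzRingType.

(** The point above [a] at height [z], inside the coordinate space of dimension [d + 1] that
    contains every graph. *)
Definition embed (a : 'I_d -> R) (z : R) : 'rV[R]_D :=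
  \row_i (if insub (val i) is Some j then a j else if i == graph_coord then z else 0).

Lemma embed_base a z i : embed a z ord0 (base_coord i) = a i.
Proof.
by rewrite mxE (insubT (fun k => k < d)%N (ltn_ord i)); congr a; apply: val_inj.
Qed.

Lemma embed_graph a z : embed a z ord0 graph_coord = z.
Proof. by rewrite mxE insubF ?eqxx //= ltnn. Qed.

Lemma embed_rest a z (j : 'I_D) : (d < j)%N -> embed a z ord0 j = 0.
Proof.
move=> dj; rewrite mxE insubF; last by apply/negbTE; rewrite -leqNgt ltnW.
by case: eqP => // e; rewrite e /= ltnn in dj.
Qed.

Lemma embedP (x : 'rV[R]_D) : (forall j : 'I_D, (d < j)%N -> x ord0 j = 0) ->
  x = embed (fun i => x ord0 (base_coord i)) (x ord0 graph_coord).
Proof.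
move=> x0; apply/rowP => j; case: (ltngtP j d) => jd.
- by rewrite (_ : j = base_coord (Ordinal jd)) ?embed_base //; apply: val_inj.
- by rewrite embed_rest // x0.
- by rewrite (_ : j = graph_coord) ?embed_graph //; apply: val_inj.
Qed.

Lemma eq_embed (a b : 'I_d -> R) z : a =1 b -> embed a z = embed b z.
Proof.
by move=> ab; apply/rowP => j; rewrite !mxE; case: insubP => // i _ _; apply: ab.
Qed.

Definition base_vars : d.-tuple (mpoly D R) :=
  [tuple mpolyX R (mnm1 (base_coord i)) | i < d].

Definition graph_poly (f : mpoly d R) : mpoly D R :=
  mpolyX R (mnm1 graph_coord) - comp_mpoly base_vars f.

Definition graph_eqs (f : mpoly d R) : seq (mpoly D R) :=
  graph_poly f :: [seq mpolyX R (mnm1 j) | j : 'I_D <- enum 'I_D & (d < j)%N].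

Lemma meval_graph_poly f (x : 'I_D -> R) :
  meval x (graph_poly f) = x graph_coord - meval (fun i => x (base_coord i)) f.
Proof.
rewrite mevalB mevalXU comp_mpoly_meval; congr (_ - _).
by apply: meval_eq => i; rewrite tnth_mktuple mevalXU.
Qed.

End Embedding.

Lemma map_embed (F R : comNzRingType) (phi : {rmorphism F -> R}) a z :
  map_mx phi (embed a z) = embed (fun i => phi (a i)) (phi z).
Proof.
apply/rowP => j; rewrite !mxE; case: insubP => [//|_].
by case: eqP => _ //; rewrite rmorph0.
Qed.

(** This is what makes the graph of a polynomial over [F], taken over a larger ring, definable by
    equations over [F]. *)
Lemma map_graph_eqs (F : fieldType) (R : comNzRingType) (phi : {rmorphism F -> R})
  (f : mpoly d F) :
  [seq map_mpoly phi g | g <- graph_eqs f] = graph_eqs (map_mpoly phi f).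
Proof.
rewrite /graph_eqs /= -map_comp; congr (_ :: _); last first.
  by apply: eq_map => j /=; rewrite map_mpolyX.
rewrite /graph_poly rmorphB /= map_mpolyX; congr (_ - _).
rewrite map_mpoly_comp; last exact: fmorph_inj.
congr comp_mpoly; apply: eq_from_tnth => i.
by rewrite tnth_map !tnth_mktuple map_mpolyX.
Qed.

Variable K : closedFieldType.
Implicit Types f : mpoly d K.

Definition graph_variety f : set 'rV[K]_D := zero_locus (graph_eqs f).

Lemma graph_varietyP f x : graph_variety f x <->
  x ord0 graph_coord = meval (fun i => x ord0 (base_coord i)) f /\
  forall j : 'I_D, (d < j)%N -> x ord0 j = 0.
Proof.
split=> [H|[H1 H2] g].
  split=> [|j dj].
    have := H (graph_poly f) (mem_head _ _).
    by rewrite meval_graph_poly => /eqP; rewrite subr_eq0 => /eqP.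
  have := H (mpolyX K (mnm1 j)); rewrite mevalXU; apply.
  by rewrite inE; apply/orP; right; apply: map_f; rewrite mem_filter dj mem_enum.
rewrite inE => /orP[/eqP->|/mapP[j]].
  by rewrite meval_graph_poly H1 subrr.
by rewrite mem_filter => /andP[dj _] ->; rewrite mevalXU H2.
Qed.

Lemma graph_variety_embed f a z : graph_variety f (embed a z) <-> z = meval a f.
Proof.
rewrite graph_varietyP embed_graph; split=> [[-> _]|->].
  by apply: meval_eq => i; rewrite embed_base.
split; last by move=> j; apply: embed_rest.
by apply: meval_eq => i; rewrite embed_base.
Qed.

(** If [f - g] is nonzero, it is nonzero at some [a], and the two graphs differ above [a]. *)
Lemma graph_variety_inj : injective graph_variety.
Proof.
move=> f g fg; apply/eqP; rewrite -subr_eq0; apply: contraT => /mpoly_nonvanishing[a].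
rewrite mevalB subr_eq0 => /eqP; case.
by apply/graph_variety_embed; rewrite -fg; apply/graph_variety_embed.
Qed.

(** Keeping all [d] parameters but ignoring those from index [e] on lets one parametrization scheme
    serve every member of [graph_flag]. *)
Definition trunc_vars e : d.-tuple (mpoly d K) :=
  [tuple if (i < e)%N then mpolyX K (mnm1 i) else 0 | i < d].

Definition graph_param f e : D.-tuple (mpoly d K) :=
  [tuple if insub (val i) is Some j then tnth (trunc_vars e) j
         else if i == graph_coord then comp_mpoly (trunc_vars e) f else 0 | i < D].

Definition trunc e (a : 'I_d -> K) (i : 'I_d) : K := if (i < e)%N then a i else 0.

Lemma meval_trunc_vars e a i : meval a (tnth (trunc_vars e) i) = trunc e a i.
Proof. by rewrite tnth_mktuple /trunc; case: ifP => _; rewrite ?mevalXU ?meval0. Qed.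

Lemma meval_graph_param f e a :
  \row_i meval a (tnth (graph_param f e) i) = embed (trunc e a) (meval (trunc e a) f).
Proof.
apply/rowP => i; rewrite !mxE tnth_mktuple; case: insubP => [j _ _|_].
  exact: meval_trunc_vars.
case: eqP => _; last by rewrite meval0.
by rewrite comp_mpoly_meval; apply: meval_eq => j; apply: meval_trunc_vars.
Qed.

(** The coordinate sections of the graph, from a single point at [e = 0] to the whole graph at
    [e = d]; they form the chain that bounds the dimension from below. *)
Definition graph_flag f e : set 'rV[K]_D :=
  [set x | graph_variety f x /\
           forall i : 'I_d, (e <= i)%N -> x ord0 (base_coord i) = 0]%classic.

Lemma graph_flag_full f : graph_flag f d = graph_variety f.
Proof.
apply/seteqP; split=> [x []//|x Vx]; split=> // i.
by rewrite leqNgt ltn_ord.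
Qed.

Lemma graph_flag_param f e x :
  graph_flag f e x <-> exists a, x = \row_i meval a (tnth (graph_param f e) i).
Proof.
split=> [[Vx xe]|[a ->]].
  exists (fun i => x ord0 (base_coord i)); rewrite meval_graph_param.
  have tr : trunc e (fun i => x ord0 (base_coord i)) =1 (fun i => x ord0 (base_coord i)).
    by move=> i; rewrite /trunc; case: ltnP => // /xe.
  have [E x0] := (graph_varietyP f x).1 Vx.
  by rewrite (meval_eq _ tr) (eq_embed _ tr) -E; apply: embedP.
rewrite meval_graph_param; split; first exact/graph_variety_embed.
by move=> i ei; rewrite embed_base /trunc ltnNge ei.
Qed.

Lemma variety_graph_flag f e : variety (graph_flag f e).
Proof.
apply: (@variety_param _ _ _ (graph_param f e)).
- exists (graph_eqs f ++
    [seq mpolyX K (mnm1 (base_coord i)) | i : 'I_d <- enum 'I_d & (e <= i)%N]).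
  apply/seteqP; split=> x.
    move=> [Vx xe] g; rewrite mem_cat => /orP[/Vx //|/mapP[i]].
    by rewrite mem_filter => /andP[ei _] ->; rewrite mevalXU xe.
  move=> H; split=> [g gf|i ei]; first by apply: H; rewrite mem_cat gf.
  have := H (mpolyX K (mnm1 (base_coord i))); rewrite mevalXU; apply.
  rewrite mem_cat; apply/orP; right; apply/mapP; exists i => //.
  by rewrite mem_filter ei mem_enum.
- by move=> a; apply/graph_flag_param; exists a.
- by move=> x /graph_flag_param.
Qed.

Lemma variety_graph f : variety (graph_variety f).
Proof. by rewrite -graph_flag_full; apply: variety_graph_flag. Qed.

Lemma has_dim_graph f : has_dim (graph_variety f) d.
Proof.
split.
  exists (graph_flag f); split=> [e _|e ed|]; first exact: variety_graph_flag.
    split=> [x [Vx xe]|sub]; first by split=> // i ei; apply: xe; apply: ltnW.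
    (* The point above the [e]-th unit vector lies in the section for [e.+1] but not in that for
       [e]. *)
    pose a (i : 'I_d) : K := (i == e :> nat)%:R.
    have [] : graph_flag f e (embed a (meval a f)).
      apply: sub; split; first exact/graph_variety_embed.
      move=> i ei; rewrite embed_base /a; case: eqP => // ie.
      by rewrite ie ltnn in ei.
    move=> _ /(_ (Ordinal ed) (leqnn _)); rewrite embed_base /a eqxx => /eqP.
    by rewrite oner_eq0.
  by rewrite graph_flag_full.
move=> k; rewrite -graph_flag_full; apply: variety_chain_param => x.
by move/graph_flag_param; apply.
Qed.

(** Substituting variables for variables does not raise the degree; [0 < e] accommodates the linear
    term of [graph_poly]. *)
Lemma msize_graph_poly f e : (0 < e)%N -> (mmeasure mdeg f <= e.+1)%N ->
  (mmeasure mdeg (graph_poly f) <= e.+1)%N.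
Proof.
move=> e0 fe; apply: leq_trans (mmeasureD_le _ _ _) _.
rewrite geq_max mmeasureN msizeX mdeg1 ltnS e0 /=.
rewrite comp_mpolyEX; apply: leq_trans (mmeasure_sum _ _ _ _) _.
apply/bigmax_leqP_seq => m ms _.
apply: leq_trans (msizeZ_le _ _) _.
apply: leq_trans (_ : (mdeg m).+1 <= _)%N; last exact: leq_trans (msize_mdeg_lt ms) fe.
rewrite comp_mpolyX mdegE.
apply: (big_ind2 (fun (p : mpoly D K) (k : nat) => mmeasure mdeg p <= k.+1)%N).
- by rewrite msize1.
- by move=> p a q b; apply: msizeM_deg.
- move=> i _; rewrite -[X in (_ <= X.+1)%N]muln1; apply: msizeX_deg.
  by rewrite tnth_mktuple msizeX mdeg1.
Qed.

Lemma has_degree_graph f e : (0 < e)%N -> (mmeasure mdeg f <= e.+1)%N ->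
  exists2 k, has_degree (graph_variety f) k & (k <= e)%N.
Proof.
move=> e0 fe; apply: has_degree_leq (has_dim_graph f) _ _.
  (* Setting the base coordinates to zero cuts the graph in the single point above the origin. *)
  exists [set x : 'rV[K]_D | x *m pid_mx d = (0 : 'rV[K]_d)]%classic, 1%N; split.
    exists (pid_mx d), 0; split=> //.
    by rewrite rank_pid_mx // ltnW.
  rewrite (_ : (_ `&` _)%classic = [set embed (fun=> 0) (meval (fun=> 0) f)]%classic).
    exact: card_set1.
  have pidE (x : 'rV[K]_D) (i : 'I_d) :
      (x *m (pid_mx d : 'M_(D, d))) ord0 i = x ord0 (base_coord i).
    rewrite mxE (bigD1 (base_coord i)) //= mxE eqxx /= ltn_ord mulr1 big1 ?addr0 //.
    move=> j ji; rewrite mxE; case: eqP => [e'|]; last by rewrite mulr0.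
    by case/eqP: ji; apply: val_inj.
  apply/seteqP; split=> x.
    case=> Vx xd; have xb i : x ord0 (base_coord i) = 0 by rewrite -pidE xd mxE.
    have [E x0] := (graph_varietyP f x).1 Vx.
    rewrite /= (embedP x0) E (eq_embed _ xb); congr embed.
    exact: meval_eq.
  move=> ->; split; first exact/graph_variety_embed.
  by apply/rowP => i; rewrite pidE embed_base mxE.
move=> L j [M [b [_ LE]]] /card_eq_II_seq[xs [xsU <- xsP]].
(* Within [L'] the coordinates beyond index [d] already vanish, so the graph is cut out by
   [graph_poly f] alone. *)
pose L' : set 'rV[K]_D :=
  [set x | L x /\ forall j : 'I_D, (d < j)%N -> x ord0 j = 0]%classic.
apply: (@size_finite_zeros _ _ (graph_poly f) L') => //; last exact: msize_graph_poly.
  move=> x y z a c; rewrite /L' LE /= => -[xM x0] [yM y0] [zM z0]; split.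
    by rewrite !mulmxDl -!scalemxAl !mulmxBl xM yM zM !subrr !scaler0 !addr0.
  by move=> i di; rewrite !mxE x0 // y0 // z0 // !subrr !mulr0 !addr0.
move=> x; rewrite xsP; split=> [[/graph_varietyP[E x0] Lx]|[[Lx x0] g0]].
  by split=> //; rewrite meval_graph_poly E subrr.
split=> //; apply/graph_varietyP; split=> //; apply/eqP; rewrite -subr_eq0.
by rewrite -meval_graph_poly g0.
Qed.

End GraphVarieties.

(** * The probabilistic choice *)

Section Selection.
Local Open Scope nat_scope.

Lemma card_ffun_constrained (n : nat) (C : finType) (S : {set 'I_n}) (F : {set C}) :
  #|[set t : {ffun 'I_n -> C} | [forall i in S, t i \in F]]| =
  #|F| ^ #|S| * #|C| ^ (n - #|S|).
Proof.
pose G i := if i \in S then mem F else mem C.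
rewrite (@eq_card _ _ (family G)) => [|t]; last first.
  rewrite inE; apply/forall_inP/familyP => [H i|H i iS].
    by rewrite /G; case: ifP => // /H.
  by have := H i; rewrite /G iS.
rewrite card_family foldrE big_image /= (bigID (mem S)) /=; congr (_ * _).
  rewrite (eq_bigl (fun i => i \in S)) // (eq_bigr (fun=> #|F|)) => [|i iS].
    by rewrite prod_nat_const.
  by rewrite /G iS.
rewrite (eq_bigl (fun i => i \in (~: S)%SET)) => [|i]; last by rewrite inE.
rewrite (eq_bigr (fun=> #|C|)) => [|i]; last by rewrite inE /G => /negbTE->.
by rewrite prod_nat_const cardsCs finset.setCK card_ord.
Qed.

Lemma ffact_leq_exp n k : n ^_ k <= n ^ k.
Proof.
elim: k => [|k IH]; first by rewrite ffactn0 expn0.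
by rewrite ffactnSr expnSr leq_mul // leq_subr.
Qed.

(** From [2 <= k!]. The factor 2 keeps the total weight of the bad events in [Kss_free_selection]
    below 1. *)
Lemma double_bin_leq n k : 1 < k -> 2 * 'C(n, k) <= n ^ k.
Proof.
move=> k1; apply: leq_trans (ffact_leq_exp n k).
rewrite -bin_ffact mulnC leq_mul2l; apply/orP; right.
by apply: leq_trans k1 _; apply: fact_geq.
Qed.

(** The summand at [k] counts the tuples that send all of [S k] into [F k]; if the total is below
    [#|C| ^ n], some tuple is counted by none. *)
Lemma union_bound (C : finType) (n : nat) (I : finType) (P : pred I)
    (S : I -> {set 'I_n}) (F : I -> {set C}) :
  \sum_(k | P k) #|F k| ^ #|S k| * #|C| ^ (n - #|S k|) < #|C| ^ n ->
  exists t : {ffun 'I_n -> C}, forall k, P k -> exists2 i, i \in S k & t i \notin F k.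
Proof.
move=> H; apply: contrapT => no; move: H; rewrite ltnNge => /negP; apply.
have bad (t : {ffun 'I_n -> C}) : exists2 k, P k & [forall i in S k, t i \in F k].
  apply: contrapT => H; apply: no; exists t => k Pk; apply: contrapT => H'.
  apply: H; exists k => //; apply/forall_inP => i iS; apply: contraT => ti.
  by case: H'; exists i.
rewrite -[X in _ ^ X]card_ord -card_ffun -sum1_card.
under [leqRHS]eq_bigr do rewrite -card_ffun_constrained -sum1_card big_mkcond.
rewrite exchange_big /=; apply: leq_sum => t _.
have [k Pk tk] := bad t.
by rewrite (bigD1 k) //= inE tk.
Qed.

Lemma card_draws_pred (T : finType) k :
  #|(fun A : {set T} => #|A| == k)| = 'C(#|T|, k).
Proof. by rewrite -card_draws cardsE. Qed.

(** Two kinds of bad events enter one union bound: [s] indices whose choices are all incident to an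
    [s]-set of points, and two indices with the same choice. *)
Lemma Kss_free_selection (C T : finType) (inc : T -> C -> bool) (n s p : nat) :
  1 < s -> 0 < p -> 0 < #|C| ->
  (forall X : {set T}, #|X| = s ->
     #|[set c | [forall x in X, inc x c]]| * p ^ s <= #|C|) ->
  n * #|T| <= p ^ s -> n * n <= #|C| ->
  exists t : {ffun 'I_n -> C}, injective t /\
    forall (S : {set 'I_n}) (X : {set T}), #|S| = s -> #|X| = s ->
      exists i x, [/\ i \in S, x \in X & ~~ inc x (t i)].
Proof.
move=> s1 p0 C0 HX nT nn.
pose FX (X : {set T}) := [set c | [forall x in X, inc x c]].
pose I := (({set 'I_n} * {set T}) + ({set 'I_n} * C))%type.
pose P (k : I) := match k with
  | inl SX => (#|SX.1| == s) && (#|SX.2| == s)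
  | inr Sc => (#|Sc.1| == 2) && (Sc.2 \in C) end.
pose S (k : I) := match k with inl SX => SX.1 | inr Sc => Sc.1 end.
pose F (k : I) := match k with inl SX => FX SX.2 | inr Sc => [set Sc.2]%SET end.
have [] := @union_bound C n I P S F.
  rewrite big_sumType /=.
  set S1 := (X in X + _ < _); set S2 := (X in _ + X < _).
  (* Each event has weight at most [p ^ - (s * s)], and there are at most [(n * #|T|) ^ s / 4] of
     them. *)
  have S1_le : 4 * S1 <= #|C| ^ n.
    have p0' : 0 < p ^ (s * s) by rewrite expn_gt0 p0.
    rewrite -(leq_pmul2r p0') -mulnA.
    have : S1 * p ^ (s * s) <= 'C(n, s) * 'C(#|T|, s) * #|C| ^ n.
      rewrite /S1 big_distrl /=.
      apply: leq_trans (_ : \sum_(k : {set 'I_n} * {set T} |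
        (#|k.1| == s) && (#|k.2| == s)) #|C| ^ n <= _).
        apply: leq_sum => -[S' X] /= /andP[/eqP S's /eqP Xs].
        have sn : s <= n by rewrite -S's -[n in _ <= n]card_ord max_card.
        rewrite S's mulnAC expnM -expnMn -[n in _ <= _ ^ n](subnKC sn) expnD leq_mul2r.
        by rewrite leq_exp2r ?HX ?orbT // ltnW.
      rewrite -(pair_big (fun S' : {set 'I_n} => #|S'| == s)
        (fun X : {set T} => #|X| == s) (fun _ _ => #|C| ^ n)) /=.
      rewrite sum_nat_const sum_nat_const mulnA.
      by rewrite !card_draws_pred card_ord.
    move=> H; apply: leq_trans (leq_mul (leqnn 4) H) _.
    rewrite (_ : 4 * _ = (2 * 'C(n, s)) * (2 * 'C(#|T|, s)) * #|C| ^ n); last by lia.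
    rewrite [leqRHS]mulnC leq_mul2r expnM; apply/orP; right.
    apply: leq_trans (leq_mul (double_bin_leq n s1) (double_bin_leq #|T| s1)) _.
    by rewrite -expnMn leq_exp2r // ltnW.
  (* Collisions have weight at most ['C(n, 2) / #|C|], which is at most one half because
     [n * n <= #|C|]. *)
  have S2_le : 2 * S2 <= #|C| ^ n.
    have -> : S2 = 'C(n, 2) * (#|C| * #|C| ^ (n - 2)).
      rewrite /S2 (eq_bigr (fun=> #|C| ^ (n - 2))); last first.
        by move=> -[S' c] /= /andP[/eqP-> _]; rewrite cards1 exp1n mul1n.
      rewrite -(pair_big (fun S' : {set 'I_n} => #|S'| == 2)
        (fun c : C => c \in C) (fun _ _ => #|C| ^ (n - 2))) /=.
      by rewrite !sum_nat_const card_draws_pred card_ord.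
    case: (ltnP n 2) => n2; first by rewrite bin_small.
    rewrite mulnA -[n in leqRHS](subnKC n2) expnD mulnA leq_mul2r; apply/orP; right.
    rewrite expnS expn1 leq_mul2r; apply/orP; right.
    by apply: leq_trans (double_bin_leq n (isT : 1 < 2)) _; rewrite expnS expn1.
  have Cn : 0 < #|C| ^ n by rewrite expn_gt0 C0.
  clearbody S1 S2; move: (#|C| ^ n) Cn S1_le S2_le => Q; lia.
move=> t tP; exists t; split.
  move=> i j tij; apply: contrapT => /eqP ij.
  have [|k kS] := tP (inr ([set i; j]%SET, t i)).
    by rewrite /= cards2 ij.
  rewrite /= inE; move: kS; rewrite /= !inE => /orP[] /eqP->; rewrite ?tij eqxx //.
move=> S' X S's Xs; have [|i iS] := tP (inl (S', X)); first by rewrite /= S's Xs !eqxx.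
rewrite /= inE => /forallPn[x]; rewrite negb_imply => /andP[xX nx].
by exists i, x.
Qed.

(** Discarding a lightest element never lowers the average weight; this is repeated until [m]
    elements remain. *)
Lemma heaviest_subset (T : finType) (w : T -> nat) (m : nat) : m <= #|T| ->
  exists A : {set T}, #|A| = m /\ m * \sum_x w x <= #|T| * \sum_(x in A) w x.
Proof.
move=> mT; rewrite -(subKn mT); move: (#|T| - m) (leq_subr m #|T|) => k.
elim: k => [|k IH] kT.
  exists [set: T]%SET; rewrite subn0 cardsT; split=> //.
  by rewrite [X in _ <= _ * X](eq_bigl xpredT) // => x; rewrite inE.
have [A [Ak Aw]] := IH (ltnW kT).
have : 0 < #|A| by rewrite Ak; lia.
case/card_gt0P => x0 x0A.
case: (arg_minnP w x0A) => x x_in xmin; have xA : x \in A := x_in.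
exists (A :\ x)%SET; split; first by have := cardsD1 x A; rewrite xA; lia.
move: Aw; rewrite (big_setD1 x) //=; set W := \sum_(_ in _) w _.
have wx : #|(A :\ x)%SET| * w x <= W.
  rewrite -sum_nat_const; apply: leq_sum => y; rewrite inE => /andP[_ yA]; exact: xmin.
have -> : #|T| - k = (#|T| - k.+1).+1 by lia.
have Ax : #|(A :\ x)%SET| = #|T| - k.+1 by have := cardsD1 x A; rewrite xA; lia.
move: wx; rewrite Ax; move: (#|T| - _) (\sum_x w x) => j V wx Aw.
rewrite -(leq_pmul2l (ltn0Sn j)).
apply: leq_trans (_ : j * (#|T| * (w x + W)) <= _).
  by rewrite mulnCA leq_mul2l Aw orbT.
by rewrite mulnCA [leqRHS]mulnCA leq_mul2l mulnDr mulSn leq_add2r wx orbT.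
Qed.

End Selection.

(** * Interpolation by polynomials of bounded degree over a finite field *)

Section BoundedDegreePolynomials.
Variables (F : finFieldType) (d b : nat).

Local Notation coeff_space := {ffun bmultinom d b -> F}.

Definition poly_of (c : coeff_space) : mpoly d F :=
  \sum_(m : bmultinom d b) c m *: mpolyX F m.

Definition coeffs_of (q : mpoly d F) : coeff_space :=
  [ffun m : bmultinom d b => mcoeff m q].

Lemma poly_ofK : cancel poly_of coeffs_of.
Proof.
move=> c; apply/ffunP => m; rewrite ffunE /poly_of raddf_sum /= (bigD1 m) //=.
rewrite mcoeffZ mcoeffX eqxx mulr1 big1 ?addr0 // => m' mm'.
rewrite mcoeffZ mcoeffX; case: eqP => [e|]; last by rewrite mulr0.
by case/eqP: mm'; apply: val_inj.
Qed.

Lemma coeffs_ofK q : (mmeasure mdeg q <= b)%N -> poly_of (coeffs_of q) = q.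
Proof.
by move=> qb; rewrite [RHS](mpolywE qb); apply: eq_bigr => m _; rewrite ffunE.
Qed.

Lemma msize_poly_of c : (mmeasure mdeg (poly_of c) <= b)%N.
Proof.
apply: leq_trans (mmeasure_sum _ _ _ _) _.
apply/bigmax_leqP_seq => m _ _; apply: leq_trans (msizeZ_le _ _) _.
by rewrite msizeX; apply: bmdeg.
Qed.

(** The powers of one variable already supply [b] monomials of degree less than [b]. *)
Lemma card_coeff_space : (0 < d)%N -> (#|F| ^ b <= #|{: coeff_space}|)%N.
Proof.
move=> d0; rewrite card_ffun leq_exp2l; last exact: finNzRing_gt1.
pose i0 : 'I_d := Ordinal d0.
have dP (j : 'I_b) : (mdeg (mnm_muln (mnm1 i0) j) < b)%N by rewrite mdegMn mdeg1 mul1n.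
rewrite -[X in (X <= _)%N]card_ord; apply: (@leq_card _ _ (fun j => BMultinom (dP j))).
move=> j k /(congr1 (fun m : bmultinom d b => (m : multinom d) i0)) /=.
by rewrite !mulmnE mnm1E eqxx !mul1n => /val_inj.
Qed.

(** A product of affine forms, one for each other point [y] of [Y], equal to 1 at [a] and 0 at [y];
    such a form comes from a coordinate in which [a] and [y] differ. *)
Lemma lagrange_poly (Y : {set 'rV[F]_d}) (a : 'rV[F]_d) : a \in Y ->
  exists L : mpoly d F, [/\ (mmeasure mdeg L <= #|Y|)%N, meval (a ord0) L = 1 &
    forall y, y \in Y -> y != a -> meval (y ord0) L = 0].
Proof.
move=> aY.
have sep (y : 'rV[F]_d) : exists l : mpoly d F, [/\ (mmeasure mdeg l <= 2)%N,
    meval (a ord0) l = 1 & y != a -> meval (y ord0) l = 0].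
  have [->|ya] := eqVneq y a.
    by exists 1; split=> //; rewrite ?msize1 ?meval1 ?eqxx.
  have : y - a != 0 by rewrite subr_eq0.
  case/rV0Pn => k; rewrite !mxE => yk.
  have ak : a ord0 k - y ord0 k != 0 by rewrite subr_eq0 eq_sym -subr_eq0.
  exists ((a ord0 k - y ord0 k)^-1 *: (mpolyX F (mnm1 k) - mpolyC d (y ord0 k))).
  split=> [||_]; last by rewrite mevalZ mevalB mevalXU mevalC subrr mulr0.
    apply: leq_trans (msizeZ_le _ _) _; apply: leq_trans (mmeasureD_le _ _ _) _.
    by rewrite mmeasureN msizeX mdeg1 mmeasureC; case: eqP.
  by rewrite mevalZ mevalB mevalXU mevalC mulVf.
have [l lP] := choice sep.
exists (\prod_(y in Y :\ a) l y)%SET; split.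
- rewrite (cardsD1 a) aY add1n -sum1_card.
  apply: (big_ind2 (fun (p : mpoly d F) (k : nat) => mmeasure mdeg p <= k.+1)%N).
  + by rewrite msize1.
  + by move=> p i q j; apply: msizeM_deg.
  + by move=> y _; case: (lP y).
- by rewrite rmorph_prod big1 // => y _; case: (lP y).
- move=> y yY ya; rewrite rmorph_prod (bigD1 y) /=; last by rewrite !inE ya.
  by case: (lP y) => _ _ /(_ ya) ->; rewrite mul0r.
Qed.

Definition on_graph (x : 'rV[F]_d * F) (c : coeff_space) :=
  x.2 == meval (x.1 ord0) (poly_of c).

(* Adding a combination of Lagrange polynomials moves the values at the points
   of [X] independently, so the translates of the interpolating family are
   disjoint. *)
Lemma card_interpolants (X : {set 'rV[F]_d * F}) : (#|X| <= b)%N ->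
  (#|[set c | [forall x in X, on_graph x c]]%SET| * #|F| ^ #|X| <= #|{: coeff_space}|)%N.
Proof.
move=> Xb; set FX := finset _.
have [->|/set0Pn[c0 c0F]] := eqVneq FX finset.set0; first by rewrite cards0.
have onX c x : c \in FX -> x \in X -> x.2 = meval (x.1 ord0) (poly_of c).
  by rewrite inE => /forall_inP H /H /eqP.
(* Since some polynomial interpolates [X], two points of [X] above the same base point coincide. *)
have fst_inj : {in X &, injective (fun x : 'rV[F]_d * F => x.1)}.
  move=> [a z] [a' z'] xX yX /= e; rewrite -e in yX *.
  by rewrite [z](onX _ _ c0F xX) [z'](onX _ _ c0F yX).
pose Y := [set x.1 | x in X]%SET.
have cY : #|Y| = #|X| by apply: card_in_imset.
pose pt (i : 'I_#|X|) : 'rV[F]_d * F := enum_val i.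
have ptX i : pt i \in X by apply: enum_valP.
have exL (i : 'I_#|X|) : exists L : mpoly d F, [/\ (mmeasure mdeg L <= b)%N,
    meval ((pt i).1 ord0) L = 1 &
    forall j, j != i -> meval ((pt j).1 ord0) L = 0].
  have [L [L1 L2 L3]] := @lagrange_poly Y (pt i).1 (imset_f _ (ptX i)).
  exists L; split=> //; first by rewrite (leq_trans L1) // cY.
  move=> j ji; apply: L3; first exact: imset_f (ptX j).
  apply: contra ji => /eqP /fst_inj e; apply/eqP/enum_val_inj.
  by apply: e; apply: ptX.
have [L LP] := choice exL.
pose Q (cy : coeff_space * {ffun 'I_#|X| -> F}) := poly_of cy.1 + \sum_i cy.2 i *: L i.
have Qb cy : (mmeasure mdeg (Q cy) <= b)%N.
  apply: leq_trans (mmeasureD_le _ _ _) _; rewrite geq_max msize_poly_of /=.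
  apply: leq_trans (mmeasure_sum _ _ _ _) _.
  apply/bigmax_leqP_seq => i _ _; apply: leq_trans (msizeZ_le _ _) _.
  by case: (LP i).
have Qev (cy : coeff_space * {ffun 'I_#|X| -> F}) i :
    cy.1 \in FX -> meval ((pt i).1 ord0) (Q cy) = (pt i).2 + cy.2 i.
  move=> cF; rewrite mevalD -(onX _ _ cF (ptX i)); congr (_ + _).
  rewrite raddf_sum /= (bigD1 i) //= mevalZ; case: (LP i) => _ -> _.
  rewrite mulr1 big1 ?addr0 // => j ji; rewrite mevalZ.
  by case: (LP j) => _ _ ->; rewrite ?mulr0 // eq_sym.
pose Phi cy := coeffs_of (Q cy).
have Phi_inj : {in (finset.setX FX [set: {ffun 'I_#|X| -> F}])%SET &, injective Phi}.
  move=> [c y] [c' y']; rewrite !inE /= !andbT => cF cF' /(congr1 poly_of).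
  rewrite !coeffs_ofK // => e.
  have yy : y = y'.
    apply/ffunP => i; have := congr1 (meval ((pt i).1 ord0)) e.
    by rewrite !Qev ?inE //= => /addrI.
  move: e; rewrite /Q yy /= => /addIr /(congr1 coeffs_of).
  by rewrite !poly_ofK => ->.
have := max_card (mem (Phi @: (finset.setX FX [set: {ffun 'I_#|X| -> F}])%SET)).
by rewrite card_in_imset // cardsX cardsT card_ffun card_ord.
Qed.

End BoundedDegreePolynomials.

(** * From a choice of polynomials to points, varieties and their incidence graph *)

Lemma meval_map_mpoly n (F R : comNzRingType) (phi : {rmorphism F -> R}) (a : 'I_n -> F)
  (f : mpoly n F) : meval (fun i => phi (a i)) (map_mpoly phi f) = phi (meval a f).
Proof.
rewrite !raddf_sum /=; apply: eq_bigr => m _.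
rewrite mevalM mevalC mmap1_id mevalX rmorphM rmorph_prod; congr (_ * _).
by apply: eq_bigr => i _; rewrite rmorphXn.
Qed.

Lemma msize_map_mpoly_leq n (F R : comNzRingType)
  (phi : {rmorphism F -> R}) (f : mpoly n F) :
  (mmeasure mdeg (map_mpoly phi f) <= mmeasure mdeg f)%N.
Proof.
apply: leq_trans (mmeasure_sum _ _ _ _) _.
apply/bigmax_leqP_seq => m ms _; rewrite mmap1_id mul_mpolyC.
apply: leq_trans (msizeZ_le _ _) _; rewrite msizeX.
exact: msize_mdeg_lt.
Qed.

(** Edges are counted as two-element sets of vertices, and distinct incident pairs give distinct
    such sets. *)
Lemma num_incidences_geq p D (P : {fset 'rV['F_p]_D}) (Vs : {fset set 'rV[Fpbar p]_D}) :
  (\sum_(x <- P) \sum_(V <- Vs) incident x V <= num_incidences P Vs)%N.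
Proof.
rewrite (big_seq_fsetE _ _ _ (fun x => \sum_(V <- Vs) incident x V)%N) /=.
under eq_bigr do rewrite (big_seq_fsetE _ _ _ (fun V => incident _ V : nat)) /=.
rewrite pair_big /= -big_mkcond sum1_card.
pose edge (uv : P * Vs) : {set P + Vs} := [set inl uv.1; inr uv.2]%SET.
have edge_inj : injective edge.
  move=> [u v] [u' v'] /= /setP H.
  have := H (inl u); have := H (inr v); rewrite !inE !eqxx /= ?orbT.
  by move=> /esym/eqP [->] /esym; rewrite orbF => /eqP[->].
rewrite -(card_imset _ edge_inj); apply: subset_leq_card; apply/fintype.subsetP => E.
case/imsetP => -[u v]; rewrite inE => uv ->; rewrite inE.
apply/existsP; exists (inl u); apply/existsP; exists (inr v); apply/andP; split.
  by rewrite /incidence_graph /incident inE.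
by rewrite /edge /=.
Qed.

(** Every vertex of one side is adjacent to a fixed vertex of the other, so each side consists of
    points only or varieties only; the sides are swapped if necessary. *)
Lemma Kss_sides p D (P : {fset 'rV['F_p]_D}) (Vs : {fset set 'rV[Fpbar p]_D}) s :
  (0 < s)%N -> contains_Kss (@incidence_graph p D P Vs) s ->
  exists (A B : {set P + Vs}), [/\ #|A| = s, #|B| = s,
    forall a, a \in A -> exists u, a = inl u,
    forall b, b \in B -> exists v, b = inr v &
    forall u v, inl u \in A -> inr v \in B -> incident (val u) (val v)].
Proof.
move=> s0 [A [B [As Bs _ e]]].
have [a0 a0A] : exists a, a \in A by apply/card_gt0P; rewrite As.
have [b0 b0B] : exists b, b \in B by apply/card_gt0P; rewrite Bs.
have e0 := e _ _ a0A b0B.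
case: a0 b0 a0A b0B e0 => [u|v] [u'|v'] // a0A b0B _.
  exists A, B; split=> //.
  - by move=> [w|w] wA; [exists w|have := e _ _ wA b0B].
  - by move=> [w|w] wB; [have := e _ _ a0A wB|exists w].
  - by move=> w w' wA w'B; apply: e wA w'B.
exists B, A; split=> //.
- by move=> [w|w] wB; [exists w|have := e _ _ a0A wB].
- by move=> [w|w] wA; [have := e _ _ wA b0B|exists w].
- by move=> w w' wA w'B; apply: e w'B wA.
Qed.

(** The selection is made among coefficient families, with all of [F_p^(d+1)] as the point set. The
    [m] points of largest multiplicity are kept, and everything is carried over by [embed] and
    [graph_variety]. *)
Lemma incidence_construction (p d D s m n : nat) :
  prime p -> (0 < d)%N -> (d < D)%N -> (1 < s)%N -> (0 < n)%N ->
  (m <= p ^ d.+1)%N -> (n * p ^ d.+1 <= p ^ s)%N ->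
  exists (P : {fset 'rV['F_p]_D}) (Vs : {fset set 'rV[Fpbar p]_D}),
    [/\ #|` P| = m, #|` Vs| = n,
        forall V, V \in Vs -> [/\ variety_over_Fp V, has_dim V d &
          exists2 k, has_degree V k & (k <= s ^ 2)%N],
        ~ contains_Kss (@incidence_graph p D P Vs) s &
        (m * n <= p * num_incidences P Vs)%N].
Proof.
move=> p_pr d0 ltdD s1 n0 mp nps.
have p0 := prime_gt0 p_pr.
have cF : #|{: 'F_p}| = p by rewrite card_Fp.
pose b := (s ^ 2)%N; have b0 : (0 < b)%N by rewrite expn_gt0 ltnW.
pose C : finType := {ffun bmultinom d b -> 'F_p}.
pose T : finType := ('rV['F_p]_d * 'F_p)%type.
have cT : #|T| = (p ^ d.+1)%N by rewrite card_prod card_mx !cF mul1n expnSr.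
have cC : (p ^ b <= #|C|)%N by rewrite -[X in (X ^ _ <= _)%N]cF card_coeff_space.
pose inc (x : T) (c : C) : bool := on_graph x c.
have [] := @Kss_free_selection C T inc n s p s1 p0.
- by apply: leq_trans cC; rewrite expn_gt0 p0.
- move=> X Xs; have Xb : (#|X| <= b)%N by rewrite Xs /b expnS expn1 leq_pmulr // ltnW.
  by have := card_interpolants Xb; rewrite Xs cF.
- by rewrite cT.
- apply: leq_trans cC.
  have ns : (n <= p ^ s)%N.
    by apply: leq_trans nps; rewrite leq_pmulr // expn_gt0 p0.
  apply: leq_trans (leq_mul ns ns) _; rewrite -expnD leq_exp2l ?prime_gt1 //.
  by rewrite /b expnS expn1 addnn -mul2n leq_mul2r s1 orbT.
move=> t [t_inj tP].
pose w (x : T) := (\sum_(i < n) inc x (t i))%N.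
(* Each graph has exactly one rational point above each of the [p ^ d] base points. *)
have sw : (\sum_x w x = n * p ^ d)%N.
  rewrite /w exchange_big /= -[n in RHS]card_ord -sum_nat_const; apply: eq_bigr => i _.
  rewrite -(pair_bigA _ (fun a z => inc (a, z) (t i) : nat)) /=.
  rewrite (eq_bigr (fun=> 1%N)) => [|a _].
    by rewrite sum1_card card_mx cF mul1n.
  rewrite (bigD1 (meval (a ord0) (poly_of (t i)))) //= /inc /on_graph eqxx /= big1 // => z.
  by move=> /negbTE ->.
have [A [Am Aw]] : exists A : {set T}, #|A| = m /\
    (m * \sum_x w x <= #|T| * \sum_(x in A) w x)%N.
  by apply: heaviest_subset; rewrite cT.
pose phi := to_Fpbar p.
pose emb (x : T) : 'rV['F_p]_D := embed ltdD (x.1 ord0) x.2.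
pose V (i : 'I_n) : set 'rV[Fpbar p]_D :=
  graph_variety ltdD (map_mpoly phi (poly_of (t i))).
have emb_inj : injective emb.
  move=> [a z] [a' z'] e; congr pair.
    apply/rowP => i.
    by rewrite -(embed_base ltdD (a ord0) z i)
         -(embed_base ltdD (a' ord0) z' i) -/(emb (a, z)) e.
  by rewrite -(embed_graph ltdD (a ord0) z)
       -(embed_graph ltdD (a' ord0) z') -/(emb (a, z)) e.
have V_inj : injective V.
  move=> i j /graph_variety_inj e; apply: t_inj; apply: (can_inj (@poly_ofK _ _ _)).
  apply/mpolyP => k; apply: (fmorph_inj phi).
  by rewrite -!mcoeff_map_mpoly e.
have incE x i : incident (emb x) (V i) = inc x (t i).
  rewrite /incident /emb map_embed; apply/idP/idP.
    rewrite inE => /graph_variety_embed; rewrite meval_map_mpoly => /fmorph_inj e.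
    by rewrite /inc /on_graph e.
  by move=> /eqP e; rewrite inE; apply/graph_variety_embed; rewrite meval_map_mpoly e.
pose P := [fset x in [seq emb x | x <- enum A]]%fset.
pose Vs := [fset v in [seq V i | i <- enum 'I_n]]%fset.
have permP : perm_eq (enum_fset P) [seq emb x | x <- enum A].
  apply: uniq_perm; [exact: fset_uniq|by rewrite (map_inj_uniq emb_inj) enum_uniq|].
  by move=> x; rewrite -[LHS]/(x \in P) !inE.
have permV : perm_eq (enum_fset Vs) [seq V i | i <- enum 'I_n].
  apply: uniq_perm; [exact: fset_uniq|by rewrite (map_inj_uniq V_inj) enum_uniq|].
  by move=> x; rewrite -[LHS]/(x \in Vs) !inE.
exists P, Vs; split.
- by rewrite (perm_size permP) size_map -cardE.
- by rewrite (perm_size permV) size_map -cardE card_ord.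
- move=> U; rewrite inE /= => /mapP[i _ ->]; split.
  + split; first exact: variety_graph.
    by exists (graph_eqs ltdD (poly_of (t i))); rewrite map_graph_eqs.
  + exact: has_dim_graph.
  + apply: has_degree_graph => //; apply: leqW.
    exact: leq_trans (msize_map_mpoly_leq _ _) (msize_poly_of (t i)).
- move=> /(Kss_sides (ltnW s1))[X [S [Xs Ss XP SV XS]]].
  have exP (u : P) : exists x, emb x = val u.
    have := valP u; rewrite inE => /mapP[x _ e]; by exists x.
  have exV (v : Vs) : exists i, V i = val v.
    have := valP v; rewrite inE => /mapP[i _ e]; by exists i.
  have [rP rPE] := choice exP; have [rV rVE] := choice exV.
  (* The values on the wrong side of the sum are fillers; [hP] is applied to points only and [hV] to
     varieties only. *)
  pose hP (u : P + Vs) : T := if u is inl u then rP u else (0, 0).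
  pose hV (u : P + Vs) : 'I_n := if u is inr v then rV v else Ordinal n0.
  have [||i [x [/imsetP[v vS ->] /imsetP[u uX ->]]]] := tP (hV @: S)%SET (hP @: X)%SET.
  + rewrite card_in_imset // => v v' vS v'S.
    have [w1 ->] := SV _ vS; have [w2 ->] := SV _ v'S => /= e.
    by congr inr; apply: val_inj; rewrite -!rVE e.
  + rewrite card_in_imset // => u u' uX u'X.
    have [w1 ->] := XP _ uX; have [w2 ->] := XP _ u'X => /= e.
    by congr inl; apply: val_inj; rewrite -!rPE e.
  have [v' ev] := SV _ vS; have [u' eu] := XP _ uX.
  rewrite ev eu /= -incE rPE rVE => /negP; apply.
  by apply: XS; rewrite -?ev -?eu.
- have swA : (\sum_(x in A) w x = \sum_(x <- P) \sum_(U <- Vs) incident x U)%N.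
    rewrite (perm_big _ permP) big_map big_enum /=; apply: eq_bigr => x _.
    rewrite (perm_big _ permV) big_map big_enum /=; apply: eq_bigr => i _.
    by rewrite incE.
  have pd0 : (0 < p ^ d)%N by rewrite expn_gt0 p0.
  have H : (m * n * p ^ d <= p * num_incidences P Vs * p ^ d)%N.
    rewrite -mulnA -sw; apply: leq_trans Aw _; rewrite swA.
    rewrite cT expnS -!mulnA leq_mul2l mulnC leq_mul2r num_incidences_geq.
    by rewrite !orbT.
  by move: H; rewrite leq_pmul2r.
Qed.

(** * Choice of the prime and comparison of exponents *)

Lemma prime_scale D : exists m0, forall d m, (d < D)%N -> (m0 <= m)%N ->
  exists p y, [/\ prime p, (m <= p ^ d.+1)%N, (p <= 16 * y)%N & (y ^ d.+1 <= m)%N].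
Proof.
(* Taking [m] at least [N ^ D] forces the least [x] with [m <= x ^ d.+1] to be at least [N],
   uniformly in [d < D]. *)
have [x0 x0P] := prime_between; pose N := x0.+2.
exists (N ^ D)%N => d m dD Dm.
have exx : exists x, (m <= x ^ d.+1)%N.
  by exists m; rewrite expnS; case: (m) => // k; rewrite leq_pmulr // expn_gt0.
case: (ex_minnP exx) => x xm xmin.
have xN : (N <= x)%N.
  rewrite leqNgt; apply/negP => xlt.
  have : (m < m)%N; last by rewrite ltnn.
  apply: leq_ltn_trans xm _; apply: leq_trans Dm.
  apply: leq_trans (_ : N ^ d.+1 <= _)%N; first by rewrite ltn_exp2r.
  by rewrite leq_pexp2l.
have x2 : (2 <= x)%N by apply: leq_trans xN.
have [|p [p_pr xp p8]] := x0P x; first by rewrite (leq_trans _ xN) // /N; lia.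
(* By minimality of [x] the power of [x.-1] stays below [m], and [8 * x <= 16 * x.-1] because
   [2 <= x]. *)
exists p, x.-1; split=> //.
- by apply: leq_trans xm _; rewrite leq_exp2r // ltnW.
- by move: p8 x2; clear; lia.
- rewrite leqNgt; apply/negP => /ltnW /xmin; move: x2; clear; lia.
Qed.

Section Exponents.
Variable R : realType.

(** From [n <= m ^ alpha <= p ^ (alpha * (d + 1))], multiplication by [p ^ (d + 1)] gives the
    exponent [(1 + alpha) * (d + 1)], which is at most [s]. *)
Lemma exponent_bound (alpha : R) (m n p d s : nat) : 0 < alpha -> (1 < p)%N ->
  n%:Z = Num.floor (m%:R `^ alpha) -> (m <= p ^ d.+1)%N ->
  (1 + alpha) * (d + 1)%:R <= s%:R -> (n * p ^ d.+1 <= p ^ s)%N.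
Proof.
move=> a0 p1 nE mp es.
have p0 : 0 <= p%:R :> R by rewrite ler0n.
have pg1 : 1 <= p%:R :> R by rewrite ler1n ltnW.
have nm : n%:R <= m%:R `^ alpha :> R.
  have : (Num.floor (m%:R `^ alpha : R))%:~R <= m%:R `^ alpha :> R by apply: floor_le.
  by rewrite -nE.
rewrite -(ler_nat R) natrM !natrX -!powR_mulrn //.
apply: le_trans (_ : p%:R `^ ((1 + alpha) * (d + 1)%:R) <= _); last by rewrite ler_powR.
rewrite addn1 [_ * d.+1%:R]mulrC mulrDr mulr1 addrC powRD; last first.
  by apply/implyP => _; rewrite pnatr_eq0 -lt0n ltnW.
have pgt : 0 < p%:R :> R by apply: lt_le_trans pg1.
rewrite ler_pM2r ?powR_gt0 //.
apply: le_trans nm _; rewrite powRrM; apply: ge0_ler_powR; rewrite ?nnegrE ?powR_ge0 //.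
  exact: ltW.
by rewrite powR_mulrn // -natrX ler_nat.
Qed.

(** With [z] the [(d + 1)]-th root of [m], one has [y <= z], so [p <= 16 * z]; dividing [m * n] by
    [16 * z] leaves the exponent [d / (d + 1)]. *)
Lemma incidence_scale (m n p y d I : nat) : (0 < m)%N -> (p <= 16 * y)%N ->
  (y ^ d.+1 <= m)%N -> (m * n <= p * I)%N ->
  16^-1 * m%:R `^ (d%:R / (d + 1)%:R) * n%:R <= I%:R :> R.
Proof.
move=> m0 py ym mnI; rewrite addn1.
have d1 : d.+1%:R != 0 :> R by rewrite pnatr_eq0.
have mR : 0 < m%:R :> R by rewrite ltr0n.
pose z : R := m%:R `^ (d.+1%:R^-1); have z0 : 0 < z by apply: powR_gt0.
have mE : m%:R = m%:R `^ (d%:R / d.+1%:R) * z.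
  rewrite /z -powRD; last by apply/implyP => _; rewrite gt_eqF.
  by rewrite -[X in _ + X]mul1r -mulrDl natr1 mulfV // powRr1 // ltW.
have yz : y%:R <= z.
  have -> : y%:R = (y%:R `^ d.+1%:R) `^ d.+1%:R^-1 :> R.
    by rewrite -powRrM mulfV // powRr1 // ler0n.
  apply: ge0_ler_powR; rewrite ?nnegrE ?invr_ge0 ?ler0n ?powR_ge0 //.
  by rewrite powR_mulrn ?ler0n // -natrX ler_nat.
have H : m%:R * n%:R <= 16 * z * I%:R.
  apply: le_trans (_ : p%:R * I%:R <= _); first by rewrite -!natrM ler_nat.
  rewrite ler_wpM2r ?ler0n //.
  apply: le_trans (_ : (16 * y)%:R <= _); first by rewrite ler_nat.
  by rewrite natrM ler_pM2l.
rewrite -mulrA mulrC ler_pdivrMr //.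
rewrite -(ler_pM2r z0) mulrAC -mE; apply: le_trans H _.
by rewrite mulrAC [16 * _]mulrC.
Qed.

End Exponents.

Unset Implicit Arguments.

Theorem theorem1p2 (R : realType) (alpha : R) (alpha_gt0 : 0 < alpha) :
  exists c : nat -> R,
    (forall d : nat, (0 < d)%N -> 0 < c d) /\
    forall D : nat, exists N0 : nat,
      forall d : nat, (0 < d)%N -> (d < D)%N ->
      forall m n : nat, (0 < m)%N -> (0 < n)%N ->
        n%:Z = Num.floor (m%:R `^ alpha) ->
        (N0 <= m)%N -> (N0 <= n)%N ->
      let s : nat := `|Num.ceil ((1 + alpha) * (d + 1)%:R)|%N in
      let Delta : nat := (s ^ 2)%N in
      exists (p : nat) (P : {fset 'rV['F_p]_D})
             (Vs : {fset set 'rV[Fpbar p]_D}),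
        [/\ prime p,
            #|` P| = m,
            #|` Vs| = n,
            forall V, V \in Vs ->
              [/\ variety_over_Fp V, has_dim V d &
                  exists2 k : nat, has_degree V k & (k <= Delta)%N] &
            ~ contains_Kss (@incidence_graph p D P Vs) s /\
            c d * m%:R `^ (d%:R / (d + 1)%:R) * n%:R <=
              (num_incidences P Vs)%:R].
Proof.
(* The constant is the reciprocal of the factor in [p <= 16 * y], the same for all [d]. *)
exists (fun=> 16^-1); split=> [d _|D]; first by rewrite invr_gt0.
have [N0 N0P] := prime_scale D.
exists N0 => d d0 dD m n m0 n0 nE mN _ s Delta.
have [p [y [p_pr mp py ym]]] := N0P d m dD mN.
have ge0 : 0 <= (1 + alpha) * (d + 1)%:R by rewrite mulr_ge0 // addr_ge0 // ltW.
(* The ceiling is nonnegative, so the absolute value in [s] leaves it unchanged. *)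
have sE : (1 + alpha) * (d + 1)%:R <= s%:R.
  rewrite /s -[X in _ <= X]/((_%:Z)%:~R) gez0_abs; first exact: ceil_ge.
  by rewrite ceil_ge0; apply: lt_le_trans ge0; rewrite oppr_lt0.
have s1 : (1 < s)%N.
  rewrite -(ltr_nat R); apply: lt_le_trans sE.
  apply: lt_le_trans (_ : 1 + alpha <= _); first by rewrite ltrDl.
  by rewrite ler_peMr ?ler1n ?addn1 // addr_ge0 // ltW.
have nps := exponent_bound alpha_gt0 (prime_gt1 p_pr) nE mp sE.
have [P [Vs [Pm Vn HV noK inc]]] := incidence_construction p_pr d0 dD s1 n0 mp nps.
exists p, P, Vs; split=> //; split=> //.
exact: incidence_scale m0 py ym inc.
Qed.
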